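(* The real polynomials $P_1$, $P_2$ and $P$ defined in the context are absolutely irreducible (i.e., irreducible over $\mathbf{C}$).
   Context: $L(3)$ is the space of traceless complex $3\times3$ matrices. Let $I=\{(1,3),(2,1),(3,2)\}$ and let $L_I\subset L(3)$ be the subspace of matrices with zero entries at the positions in $I$, i.e. matrices $$A=\begin{pmatrix} u & z & 0 \\ 0 & v & x \\ y & 0 & w \end{pmatrix},\qquad w=-u-v,\ x,y,z,u,v\in\mathbf{C}.$$ Polynomials on $L_I$ are regarded as polynomials in the 10 real variables given by the real and imaginary parts of $x,y,z,u,v$; polynomials on $L(3)$ as polynomials in the 16 real variables given by the real and imaginary parts of the entries of $X\in L(3)$ except the last (i.e. $(3,3)$) entry. $P_1:L_I\to\mathbf{R}$ is $$\begin{aligned}P_1(A)=\;&|(v-w)x^2|^2+|(w-u)y^2|^2+|(u-v)z^2|^2\\ &+(|(v-w)x|^2+|yz|^2)(|v|^2+|w|^2-5|u|^2)\\ &+(|(w-u)y|^2+|zx|^2)(|w|^2+|u|^2-5|v|^2)\\ &+(|(u-v)z|^2+|xy|^2)(|u|^2+|v|^2-5|w|^2)\\ &+|(u-v)(v-w)(w-u)|^2.\end{aligned}$$ $P_2:L_I\to\mathbf{R}$ is the homogeneous polynomial of degree 12 determined by $P_I=P_1^2P_2$, where $P_I$ is the restriction to $L_I$ of the polynomial $P$ defined next (that $P_I$ is divisible by $P_1^2$ is a fact established in the paper). Definition of $P:L(3)\to\mathbf{R}$ (homogeneous of degree 24). For $X\in L(3)$, $Y=X^*$, put $i_1=\mathrm{tr}(XY)$;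 $i_2=\mathrm{tr}(X^2Y^2)$; $i_3=\frac14|\mathrm{tr}(X^2)|^2$; $i_4=\mathrm{tr}(XYX^2Y^2)$; $i_5=\frac19|\mathrm{tr}(X^3)|^2$; $i_6=|\mathrm{tr}(X^2Y)|^2$; $i_7=\frac16\mathrm{Re}\big(\mathrm{tr}(Y^2)(3\,\mathrm{tr}(X^2Y)^2+\mathrm{tr}(X^3)\mathrm{tr}(XY^2))\big)$; $i_8=\frac16\mathrm{Re}\big(\mathrm{tr}(Y^2)(3\,\mathrm{tr}(X^2Y)^2-\mathrm{tr}(X^3)\mathrm{tr}(XY^2))\big)$; $i_{11}=\frac1{12}\mathrm{Re}(\mathrm{tr}(X^2)^2\mathrm{tr}(Y^3)\mathrm{tr}(XY^2))$; $i_{13}=\frac1{72}\mathrm{Re}(\mathrm{tr}(X^3)^2\mathrm{tr}(Y^2)^3)$; $i_{16}=\frac1{144}\mathrm{Re}(\mathrm{tr}(X^2)^4\mathrm{tr}(Y^3)^2\mathrm{tr}(XY^2)^2)$. Then $P=\sum_{k,l}p_{kl}\,i_3^k i_6^l$, where the nonzero $p_{kl}$ are: $p_{00}=-6\,(126i_2^2i_1^4-26i_2i_1^6+336i_7i_2i_1^2-270i_2^3i_1^2+1536i_7^2+216i_2^4-11i_7i_1^4+2i_1^8-1152i_7i_2^2)(i_8+i_7)$ $p_{01}=18432i_{11}i_7+186i_8i_1^5+2016i_{11}i_1^2i_2+2160i_2^2i_1i_7-66i_{11}i_1^4+2160i_8i_1i_2^2-1278i_8i_1^3i_2+186i_1^5i_7-6912i_{11}i_2^2+3456i_1i_7^2+3456i_8i_1i_7-1278i_1^3i_2i_7$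 $p_{02}=3888i_8i_2+297i_1^2i_2^2-4608i_{13}-324i_2^3-90i_1^4i_2+3888i_2i_7+9i_1^6-1242i_1^2i_7-1242i_8i_1^2-3456i_{11}i_1$ $p_{03}=18i_1(-7i_1^2+27i_2)$ $p_{04}=729$ $p_{10}=6912i_7i_4i_1i_2+2016i_2i_1^2i_{13}-33i_4i_2i_1^5+1008i_4i_2^2i_1^3-3456i_4i_1i_2^3-1008i_4^2i_2i_1^2+31104i_5^2i_2^2+33i_5i_1^7+297i_5^2i_1^4+9792i_2^3i_8-2304i_4^2i_8-251i_1^6i_8-20736i_5^2i_8-3024i_5i_4i_2i_1^2+25920i_7i_2^3-55296i_7^2i_2-6912i_7i_4^2+17760i_7^2i_1^2+3456i_4^2i_2^2+9504i_5i_2^2i_1^3-6912i_7i_5i_1^3-66i_1^4i_{13}+4608i_{16}-24012i_7i_2^2i_1^2-317i_7i_1^6-62208i_7i_5^2+2304i_4i_2i_1i_8-1206i_5i_2i_1^5+3012i_2i_1^4i_8+5226i_7i_2i_1^4-20736i_7i_5i_4+8544i_7i_1^2i_8-6912i_2^2i_{13}+9216i_7i_{13}+66i_1^5i_{11}-9072i_5^2i_2i_1^2-2304i_5i_1^3i_8-27648i_7i_2i_8-6912i_5i_4i_8-11052i_2^2i_1^2i_8+13824i_5i_2i_1i_8+10368i_5i_4i_2^2+1632i_2^2i_1^6-5151i_2^3i_1^4+7200i_2^4i_1^2-256i_2i_1^8+16i_1^{10}-1728i_2^5-2016i_2i_1^3i_{11}+41472i_7i_5i_1i_2-18432i_7i_1i_{11}+6912i_2^2i_1i_{11}-20736i_5i_1i_2^3+99i_5i_4i_1^4+33i_4^2i_1^4$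 $p_{11}=-4320i_5i_2i_1^2+6i_1^3i_8+6912i_7i_4+1728i_4^2i_1-3450i_7i_1^3-5088i_1^2i_{11}+14688i_1i_2^3+2721i_2i_1^5+2304i_4i_8-4320i_2i_1i_8+15552i_5^2i_1+1152i_1i_{13}+11520i_5i_8-3456i_4i_2^2+1440i_7i_1i_2-20736i_5i_2^2-272i_1^7+1530i_5i_1^4-33i_4i_1^4+32256i_2i_{11}+5184i_5i_4i_1-9792i_2^2i_1^3-720i_4i_2i_1^2+39168i_7i_5$ $p_{12}=-1728i_4i_1+2130i_1^4-10170i_2i_1^2+15228i_2^2+1296i_8+1296i_7-10368i_5i_1$ $p_{13}=-3726i_1$ $p_{20}=-4272i_4i_2i_1^3+16128i_4i_1i_2^2-16128i_4^2i_2+12816i_5i_4i_1^2-48384i_5i_4i_2+4272i_4^2i_1^2-27360i_2^2i_8+23808i_7i_8+80844i_7i_2i_1^2+69888i_7^2-47808i_5i_2i_1^3+117504i_5i_1i_2^2-39168i_7i_5i_1+19500i_2i_1^2i_8-8544i_1^2i_{13}+32256i_2i_{13}+8544i_1^3i_{11}+384i_1^8+20160i_2^4-128736i_7i_2^2-11607i_7i_1^4+4470i_5i_1^5-145152i_5^2i_2+38448i_5^2i_1^2-2799i_1^4i_8-11520i_5i_1i_8-50016i_2^3i_1^2-5279i_2i_1^6+26283i_2^2i_1^4-32256i_2i_1i_{11}$ $p_{21}=-22224i_7i_1-4272i_4i_1^2-37632i_{11}+16128i_4i_2+96768i_5i_2-2112i_1^5+18192i_2i_1^3-15264i_5i_1^2-8400i_1i_8-40608i_1i_2^2$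 $p_{22}=-10476i_2+10401i_1^2$ $p_{30}=44448i_5i_1^3+31296i_8i_2+4415i_1^6-76308i_1^2i_7-18816i_4i_1i_2+169344i_5^2+56448i_5i_4+128496i_1^2i_2^2+37632i_{11}i_1-209664i_5i_1i_2+18816i_4^2-9108i_8i_1^2+236352i_2i_7-37632i_{13}-90624i_2^3-43032i_1^4i_2$ $p_{31}=-117504i_5+480i_2i_1+3312i_1^3-18816i_4$ $p_{32}=-5196$ $p_{40}=-146816i_2i_1^2-10384i_8+112896i_5i_1+23948i_1^4+195840i_2^2-142480i_7$ $p_{41}=33632i_1$ $p_{50}=-202048i_2+65232i_1^2$ $p_{60}=78400$ *)

(* Defs.v *)
From mathcomp Require Import all_boot all_order all_algebra.
From mathcomp Require Import reals complex mpoly.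

Set Implicit Arguments.
Unset Strict Implicit.
Unset Printing Implicit Defensive.

Import Order.TTheory GRing.Theory Num.Theory.

Local Open Scope ring_scope.
Local Open Scope complex_scope.

(* [#n] is the ring element [n%:R] with [n] kept in decimal form: the        *)
(* numerals of [ring_scope] and the smaller ones of [nat_scope] expand to     *)
(* towers of successors.                                                      *)
#[local] Set Warnings "-abstract-large-number".
Declare Scope decimal_nat_scope.
Delimit Scope decimal_nat_scope with dnat.
Number Notation nat Nat.of_num_uint Nat.to_num_uint (abstract after 0)
  : decimal_nat_scope.
Local Notation "# n" := (n%dnat%:R) (at level 1, n at level 0, format "# n")
  : ring_scope.

Definition matrix3 (T : nzRingType) (rows : seq (seq T)) : 'M[T]_3 :=
  \matrix_(i < 3, j < 3) nth 0 (nth [::] rows i) j.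

Section Invariants.

Context {C : numClosedFieldType}.
Implicit Type X : 'M[C]_3.

Definition adjoint X : 'M[C]_3 := (map_mx Num.conj X)^T.

Definition inv1 X : C := let Y := adjoint X in \tr (X * Y).
Definition inv2 X : C := let Y := adjoint X in \tr (X ^+ 2 * Y ^+ 2).
Definition inv3 X : C := 4^-1 * `|\tr (X ^+ 2)| ^+ 2.
Definition inv4 X : C := let Y := adjoint X in \tr (X * Y * X ^+ 2 * Y ^+ 2).
Definition inv5 X : C := 9^-1 * `|\tr (X ^+ 3)| ^+ 2.
Definition inv6 X : C := let Y := adjoint X in `|\tr (X ^+ 2 * Y)| ^+ 2.
Definition inv7 X : C := let Y := adjoint X in
  6^-1 * 'Re (\tr (Y ^+ 2) *
    (3 * \tr (X ^+ 2 * Y) ^+ 2 + \tr (X ^+ 3) * \tr (X * Y ^+ 2))).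
Definition inv8 X : C := let Y := adjoint X in
  6^-1 * 'Re (\tr (Y ^+ 2) *
    (3 * \tr (X ^+ 2 * Y) ^+ 2 - \tr (X ^+ 3) * \tr (X * Y ^+ 2))).
Definition inv11 X : C := let Y := adjoint X in
  12^-1 * 'Re (\tr (X ^+ 2) ^+ 2 * \tr (Y ^+ 3) * \tr (X * Y ^+ 2)).
Definition inv13 X : C := let Y := adjoint X in
  72^-1 * 'Re (\tr (X ^+ 3) ^+ 2 * \tr (Y ^+ 2) ^+ 3).
Definition inv16 X : C := let Y := adjoint X in
  144^-1 * 'Re (\tr (X ^+ 2) ^+ 4 * \tr (Y ^+ 3) ^+ 2 * \tr (X * Y ^+ 2) ^+ 2).

End Invariants.

(* The coefficient p_{kl} of i3 ^ k * i6 ^ l in P. *)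
Definition pcoef (A : comNzRingType) (i1 i2 i4 i5 i7 i8 i11 i13 i16 : A)
    (k l : nat) : A :=
  match k, l with
  | 0%N, 0%N =>
      - #6 * (#126 * i2 ^+ 2 * i1 ^+ 4 - #26 * i2 * i1 ^+ 6
      + #336 * i7 * i2 * i1 ^+ 2 - #270 * i2 ^+ 3 * i1 ^+ 2
      + #1536 * i7 ^+ 2 + #216 * i2 ^+ 4 - #11 * i7 * i1 ^+ 4
      + #2 * i1 ^+ 8 - #1152 * i7 * i2 ^+ 2) * (i8 + i7)
  | 0%N, 1%N =>
      #18432 * i11 * i7 + #186 * i8 * i1 ^+ 5 + #2016 * i11 * i1 ^+ 2 * i2
      + #2160 * i2 ^+ 2 * i1 * i7 - #66 * i11 * i1 ^+ 4
      + #2160 * i8 * i1 * i2 ^+ 2 - #1278 * i8 * i1 ^+ 3 * i2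
      + #186 * i1 ^+ 5 * i7 - #6912 * i11 * i2 ^+ 2 + #3456 * i1 * i7 ^+ 2
      + #3456 * i8 * i1 * i7 - #1278 * i1 ^+ 3 * i2 * i7
  | 0%N, 2%N =>
      #3888 * i8 * i2 + #297 * i1 ^+ 2 * i2 ^+ 2 - #4608 * i13
      - #324 * i2 ^+ 3 - #90 * i1 ^+ 4 * i2 + #3888 * i2 * i7
      + #9 * i1 ^+ 6 - #1242 * i1 ^+ 2 * i7 - #1242 * i8 * i1 ^+ 2
      - #3456 * i11 * i1
  | 0%N, 3%N =>
      #18 * i1 * (- #7 * i1 ^+ 2 + #27 * i2)
  | 0%N, 4%N =>
      #729
  | 1%N, 0%N =>
      #6912 * i7 * i4 * i1 * i2 + #2016 * i2 * i1 ^+ 2 * i13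
      - #33 * i4 * i2 * i1 ^+ 5 + #1008 * i4 * i2 ^+ 2 * i1 ^+ 3
      - #3456 * i4 * i1 * i2 ^+ 3 - #1008 * i4 ^+ 2 * i2 * i1 ^+ 2
      + #31104 * i5 ^+ 2 * i2 ^+ 2 + #33 * i5 * i1 ^+ 7
      + #297 * i5 ^+ 2 * i1 ^+ 4 + #9792 * i2 ^+ 3 * i8
      - #2304 * i4 ^+ 2 * i8 - #251 * i1 ^+ 6 * i8 - #20736 * i5 ^+ 2 * i8
      - #3024 * i5 * i4 * i2 * i1 ^+ 2 + #25920 * i7 * i2 ^+ 3
      - #55296 * i7 ^+ 2 * i2 - #6912 * i7 * i4 ^+ 2
      + #17760 * i7 ^+ 2 * i1 ^+ 2 + #3456 * i4 ^+ 2 * i2 ^+ 2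
      + #9504 * i5 * i2 ^+ 2 * i1 ^+ 3 - #6912 * i7 * i5 * i1 ^+ 3
      - #66 * i1 ^+ 4 * i13 + #4608 * i16
      - #24012 * i7 * i2 ^+ 2 * i1 ^+ 2 - #317 * i7 * i1 ^+ 6
      - #62208 * i7 * i5 ^+ 2 + #2304 * i4 * i2 * i1 * i8
      - #1206 * i5 * i2 * i1 ^+ 5 + #3012 * i2 * i1 ^+ 4 * i8
      + #5226 * i7 * i2 * i1 ^+ 4 - #20736 * i7 * i5 * i4
      + #8544 * i7 * i1 ^+ 2 * i8 - #6912 * i2 ^+ 2 * i13
      + #9216 * i7 * i13 + #66 * i1 ^+ 5 * i11
      - #9072 * i5 ^+ 2 * i2 * i1 ^+ 2 - #2304 * i5 * i1 ^+ 3 * i8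
      - #27648 * i7 * i2 * i8 - #6912 * i5 * i4 * i8
      - #11052 * i2 ^+ 2 * i1 ^+ 2 * i8 + #13824 * i5 * i2 * i1 * i8
      + #10368 * i5 * i4 * i2 ^+ 2 + #1632 * i2 ^+ 2 * i1 ^+ 6
      - #5151 * i2 ^+ 3 * i1 ^+ 4 + #7200 * i2 ^+ 4 * i1 ^+ 2
      - #256 * i2 * i1 ^+ 8 + #16 * i1 ^+ 10 - #1728 * i2 ^+ 5
      - #2016 * i2 * i1 ^+ 3 * i11 + #41472 * i7 * i5 * i1 * i2
      - #18432 * i7 * i1 * i11 + #6912 * i2 ^+ 2 * i1 * i11
      - #20736 * i5 * i1 * i2 ^+ 3 + #99 * i5 * i4 * i1 ^+ 4
      + #33 * i4 ^+ 2 * i1 ^+ 4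
  | 1%N, 1%N =>
      - #4320 * i5 * i2 * i1 ^+ 2 + #6 * i1 ^+ 3 * i8 + #6912 * i7 * i4
      + #1728 * i4 ^+ 2 * i1 - #3450 * i7 * i1 ^+ 3
      - #5088 * i1 ^+ 2 * i11 + #14688 * i1 * i2 ^+ 3
      + #2721 * i2 * i1 ^+ 5 + #2304 * i4 * i8 - #4320 * i2 * i1 * i8
      + #15552 * i5 ^+ 2 * i1 + #1152 * i1 * i13 + #11520 * i5 * i8
      - #3456 * i4 * i2 ^+ 2 + #1440 * i7 * i1 * i2
      - #20736 * i5 * i2 ^+ 2 - #272 * i1 ^+ 7 + #1530 * i5 * i1 ^+ 4
      - #33 * i4 * i1 ^+ 4 + #32256 * i2 * i11 + #5184 * i5 * i4 * i1
      - #9792 * i2 ^+ 2 * i1 ^+ 3 - #720 * i4 * i2 * i1 ^+ 2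
      + #39168 * i7 * i5
  | 1%N, 2%N =>
      - #1728 * i4 * i1 + #2130 * i1 ^+ 4 - #10170 * i2 * i1 ^+ 2
      + #15228 * i2 ^+ 2 + #1296 * i8 + #1296 * i7 - #10368 * i5 * i1
  | 1%N, 3%N =>
      - #3726 * i1
  | 2%N, 0%N =>
      - #4272 * i4 * i2 * i1 ^+ 3 + #16128 * i4 * i1 * i2 ^+ 2
      - #16128 * i4 ^+ 2 * i2 + #12816 * i5 * i4 * i1 ^+ 2
      - #48384 * i5 * i4 * i2 + #4272 * i4 ^+ 2 * i1 ^+ 2
      - #27360 * i2 ^+ 2 * i8 + #23808 * i7 * i8
      + #80844 * i7 * i2 * i1 ^+ 2 + #69888 * i7 ^+ 2
      - #47808 * i5 * i2 * i1 ^+ 3 + #117504 * i5 * i1 * i2 ^+ 2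
      - #39168 * i7 * i5 * i1 + #19500 * i2 * i1 ^+ 2 * i8
      - #8544 * i1 ^+ 2 * i13 + #32256 * i2 * i13 + #8544 * i1 ^+ 3 * i11
      + #384 * i1 ^+ 8 + #20160 * i2 ^+ 4 - #128736 * i7 * i2 ^+ 2
      - #11607 * i7 * i1 ^+ 4 + #4470 * i5 * i1 ^+ 5
      - #145152 * i5 ^+ 2 * i2 + #38448 * i5 ^+ 2 * i1 ^+ 2
      - #2799 * i1 ^+ 4 * i8 - #11520 * i5 * i1 * i8
      - #50016 * i2 ^+ 3 * i1 ^+ 2 - #5279 * i2 * i1 ^+ 6
      + #26283 * i2 ^+ 2 * i1 ^+ 4 - #32256 * i2 * i1 * i11
  | 2%N, 1%N =>
      - #22224 * i7 * i1 - #4272 * i4 * i1 ^+ 2 - #37632 * i11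
      + #16128 * i4 * i2 + #96768 * i5 * i2 - #2112 * i1 ^+ 5
      + #18192 * i2 * i1 ^+ 3 - #15264 * i5 * i1 ^+ 2 - #8400 * i1 * i8
      - #40608 * i1 * i2 ^+ 2
  | 2%N, 2%N =>
      - #10476 * i2 + #10401 * i1 ^+ 2
  | 3%N, 0%N =>
      #44448 * i5 * i1 ^+ 3 + #31296 * i8 * i2 + #4415 * i1 ^+ 6
      - #76308 * i1 ^+ 2 * i7 - #18816 * i4 * i1 * i2 + #169344 * i5 ^+ 2
      + #56448 * i5 * i4 + #128496 * i1 ^+ 2 * i2 ^+ 2 + #37632 * i11 * i1
      - #209664 * i5 * i1 * i2 + #18816 * i4 ^+ 2 - #9108 * i8 * i1 ^+ 2
      + #236352 * i2 * i7 - #37632 * i13 - #90624 * i2 ^+ 3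
      - #43032 * i1 ^+ 4 * i2
  | 3%N, 1%N =>
      - #117504 * i5 + #480 * i2 * i1 + #3312 * i1 ^+ 3 - #18816 * i4
  | 3%N, 2%N =>
      - #5196
  | 4%N, 0%N =>
      - #146816 * i2 * i1 ^+ 2 - #10384 * i8 + #112896 * i5 * i1
      + #23948 * i1 ^+ 4 + #195840 * i2 ^+ 2 - #142480 * i7
  | 4%N, 1%N =>
      #33632 * i1
  | 5%N, 0%N =>
      - #202048 * i2 + #65232 * i1 ^+ 2
  | 6%N, 0%N =>
      #78400
  | _, _ => 0
  end.

(* [P] and [P1] take values in C, but are real-valued, and stand for functions *)
(* on L(3) and L_I: only their restrictions to these spaces matter.           *)
Definition P (C : numClosedFieldType) (X : 'M[C]_3) : C :=
  \sum_(k < 7) \sum_(l < 5)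
    pcoef (inv1 X) (inv2 X) (inv4 X) (inv5 X) (inv7 X) (inv8 X)
      (inv11 X) (inv13 X) (inv16 X) k l * inv3 X ^+ k * inv6 X ^+ l.

Definition P1 (C : numClosedFieldType) (A : 'M[C]_3) : C :=
  let u := A 0 0 in let v := A 1 1 in let w := A 2 2 in
  let x := A 1 2 in let y := A 2 0 in let z := A 0 1 in
  `|(v - w) * x ^+ 2| ^+ 2 + `|(w - u) * y ^+ 2| ^+ 2
  + `|(u - v) * z ^+ 2| ^+ 2
  + (`|(v - w) * x| ^+ 2 + `|y * z| ^+ 2)
    * (`|v| ^+ 2 + `|w| ^+ 2 - 5 * `|u| ^+ 2)
  + (`|(w - u) * y| ^+ 2 + `|z * x| ^+ 2)
    * (`|w| ^+ 2 + `|u| ^+ 2 - 5 * `|v| ^+ 2)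
  + (`|(u - v) * z| ^+ 2 + `|x * y| ^+ 2)
    * (`|u| ^+ 2 + `|v| ^+ 2 - 5 * `|w| ^+ 2)
  + `|(u - v) * (v - w) * (w - u)| ^+ 2.

Section Coordinates.

Context {R : realType}.

(* The k-th complex coordinate has real part t_(2k), imaginary part t_(2k+1). *)
Definition ccoord n (t : 'I_n.+1 -> R) (k : nat) : R[i] :=
  t (inord k.*2) +i* t (inord k.*2.+1).

Definition LI_mx (t : 'I_10 -> R) : 'M[R[i]]_3 :=
  let x := ccoord t 0 in let y := ccoord t 1 in let z := ccoord t 2 in
  let u := ccoord t 3 in let v := ccoord t 4 in let w := - u - v in
  matrix3 [:: [:: u; z; 0];
              [:: 0; v; x];
              [:: y; 0; w]].

Definition L3_mx (t : 'I_16 -> R) : 'M[R[i]]_3 :=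
  let a11 := ccoord t 0 in let a12 := ccoord t 1 in let a13 := ccoord t 2 in
  let a21 := ccoord t 3 in let a22 := ccoord t 4 in let a23 := ccoord t 5 in
  let a31 := ccoord t 6 in let a32 := ccoord t 7 in
  matrix3 [:: [:: a11; a12; a13];
              [:: a21; a22; a23];
              [:: a31; a32; - a11 - a22]].

(* [p] is the complex-valued function [f] viewed as a real polynomial; such   *)
(* a [p] is unique, and forces [f] to be real-valued.                         *)
Definition is_poly_of n (p : {mpoly R[n]}) (f : ('I_n -> R) -> R[i]) : Prop :=
  forall t, f t = (p.@[t])%:C.

End Coordinates.

Definition irreducible_elt (A : idomainType) (a : A) : Prop :=
  [/\ a != 0, a \isn't a GRing.unit
    & forall b c : A, a = b * c -> b \is a GRing.unit \/ c \is a GRing.unit].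

Definition absolutely_irreducible (R : realType) n (p : {mpoly R[n]}) : Prop :=
  irreducible_elt (map_mpoly (real_complex R) p : {mpoly R[i][n]}).

(* Main.v *)
(* Write the polynomials in the complex coordinates al_k = t_(2k) + i t_(2k+1)  *)
(* and their formal conjugates be_k; that is, treat X and the transpose of Y =  *)
(* X^* as independent points. Then P1, P2 and P are bihomogeneous in (al, be)   *)
(* and invariant under swapping al and be, and every factor of them is          *)
(* bihomogeneous. Fix be and let al range over a plane v0 + s v1 + t v2, so     *)
(* that f restricts to a polynomial in s and t on this slice. If f does not     *)
(* vanish identically at infinity of the slice, then a factor of f that         *)
(* restricts to c s^i has degree i in al.                                       *)
(* For P1 and P2 there are slices with irreducible restriction (up to a         *)
(* constant). So one of two cofactors g, h has degree 0 in al, and one has      *)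
(* degree 0 in be. That these are different factors, i.e. f = g(be) h(al), is   *)
(* excluded by evaluating f at a few points.                                    *)
(* For P, on a slice with Y = E12 + E23, one of the cofactors restricts to c    *)
(* s^i with i <= 2, and so has degree i in al; its weight under conjugation by  *)
(* the torus diag(l, 1, 1/l) then forces degree 2 i in be. The same holds with  *)
(* al and be exchanged, which is only possible if one of the cofactors has      *)
(* degree (0, 0).                                                               *)

Require Import Defs.
From HB Require Import structures.
From mathcomp Require Import all_boot all_order all_algebra.
From mathcomp Require Import reals complex mpoly.
From mathcomp Require Import ring zify.

Set Implicit Arguments.
Unset Strict Implicit.
Unset Printing Implicit Defensive.

Import Order.TTheory GRing.Theory Num.Theory.

Local Open Scope ring_scope.
Local Open Scope complex_scope.

Local Notation "# n" := (n%dnat%:R) (at level 1, n at level 0, format "# n")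
  : ring_scope.

(** * Polynomials *)

(** Over C, the pairs of real coordinates can be traded for variables z_k and their formal
    conjugates, which are independent. This gives a polynomial f(al, be) of bidegree (N, N),
    symmetric in al and be, with N = 3, 6, 12 for P1, P2, P. Factors inherit every grading given by
    integer weights, because the factors of a monomial over a domain are monomials
    ([monomial_factor], [whomog_factor]). If a factor restricts to c s^i on a plane slice in al,
    with be fixed, its al-degree is read off at infinity ([slice_monomial]).

    For P1 the slice is linear in t with coprime coefficients ([irreducible_linear]); for P2 it is a
    cubic in t without a root in C(s) ([irreducible_cubic]). Hence some factor is free of al and, by
    symmetry, some factor is free of be; [bihomog_irreducible] shows that such a factorization is
    trivial.

    For P the slice only shows that some factor restricts to c s^i with i <= 2 ([factor_square]);
    the torus weight then forces its bidegree to be (i, 2 i) ([torus_degrees]). By symmetry some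
    factor has bidegree (2 j, j) with j <= 2. If it is the same factor, i = j = 0; otherwise the
    be-degrees add up to 2 i + j <= 6 and not to 12.

    The identities are proved over arbitrary commutative rings, so that one expression ([polarP],
    [polarP1]) can be evaluated at numbers, on slices and at the variables themselves; [formal]
    turns it into a polynomial. *)

Lemma monomial_factor (A : idomainType) (p q : {poly A}) (c : A) (n : nat) :
  c != 0 -> p * q = c *: 'X^n -> exists a k, p = a *: 'X^k.
Proof.
move=> c0; elim: n p q => [|n IHn] p q.
  rewrite expr0 => pq; have : size (p * q) = 1%N.
    by rewrite pq size_scale // size_poly1.
  have p0 : p != 0 by apply: contraNneq c0 => p0; move: pq; rewrite p0 mul0r => /esym/eqP;
    rewrite -mul_polyC mulf_eq0 polyC_eq0 oner_eq0 orbF.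
  have q0 : q != 0 by apply: contraNneq c0 => q0; move: pq; rewrite q0 mulr0 => /esym/eqP;
    rewrite -mul_polyC mulf_eq0 polyC_eq0 oner_eq0 orbF.
  rewrite size_mul // => s1.
  have : (0 < size p)%N by rewrite lt0n size_poly_eq0.
  have : (0 < size q)%N by rewrite lt0n size_poly_eq0.
  have : (size p <= 1)%N.
    by move: s1 q0; rewrite -size_poly_eq0; case: (size q) => // m;
      rewrite addnS /= => <- _; rewrite leq_addr.
  move=> /size1_polyC -> _ _; exists p`_0, 0%N.
  by rewrite expr0 alg_polyC.
(* The product vanishes at 0, so one of the factors is divisible by X; dividing it out lowers n. *)
move=> pq; have : (p * q).[0] = 0 by rewrite pq hornerZ hornerXn expr0n mulr0.
have divX (r : {poly A}) : r.[0] = 0 -> exists r', r = r' * 'X.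
  move=> /eqP/factor_theorem[r' ->]; exists r'; by rewrite subr0.
rewrite hornerM => /eqP; rewrite mulf_eq0 => /orP[] /eqP /divX[r rE]; last first.
  apply: (IHn p r); apply: (mulIf (negbT (polyX_eq0 A))).
  by rewrite -mulrA -rE pq exprSr scalerAl.
have /IHn[a [k rX]] : r * q = c *: 'X^n.
  by apply: (mulIf (negbT (polyX_eq0 A))); rewrite mulrAC -rE pq exprSr scalerAl.
by exists a, k.+1; rewrite rE rX -scalerAl -exprSr.
Qed.

Lemma poly_inj_nonzero (K : numDomainType) (p q : {poly K}) :
  (forall x, x != 0 -> p.[x] = q.[x]) -> p = q.
Proof.
move=> pq; apply/eqP; rewrite -subr_eq0; apply/eqP.
pose s : seq K := [seq (i.+1)%:R | i <- iota 0 (size (p - q))].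
apply: (@roots_geq_poly_eq0 _ _ s); last by rewrite size_map size_iota.
  apply/allP => x /mapP[i _ ->]; rewrite rootE hornerD hornerN pq ?subrr //.
  by rewrite pnatr_eq0.
rewrite map_inj_uniq ?iota_uniq // => i j /eqP.
by rewrite eqr_nat eqSS => /eqP.
Qed.

(** Allows induction on the number of variables: p is recovered from its form as a univariate
    polynomial in the last variable. *)
Lemma muniK (A : comNzRingType) (n : nat) (p : {mpoly A[n.+1]}) :
  (map_poly (@mwiden n A) (muni p)).['X_ord_max] = p.
Proof.
rewrite muniE [RHS]mpolyE raddf_sum horner_sum; apply: eq_bigr => m _ /=.
rewrite -!mul_polyC rmorphM /= map_polyC map_polyXn /= hornerM hornerC hornerXn.
rewrite mwidenZ mwidenX -scalerAl mpolyXn -mpolyXD; congr (_ *: 'X_[_]).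
apply/mnmP => i; rewrite mnmDE mulmnE mnmE; have [ltin | ] := ltnP i n.
  have -> : i = widen_ord (leqnSn n) (Ordinal ltin) by apply: val_inj.
  rewrite mnmwiden_widen mnmE eq_sym; case: eqP => [/(congr1 val) /= eqn|_]; last by rewrite addn0.
  by have := ltnn n; rewrite -[X in (X < _)%N]eqn ltin.
move=> leni; have -> : i = ord_max by apply/val_inj/eqP; rewrite /= eqn_leq leni -ltnS ltn_ord.
by rewrite mnmwiden_ordmax eqxx mul1n.
Qed.

Lemma meval_mwiden (A : comNzRingType) (n : nat) (v : 'I_n.+1 -> A) (p : {mpoly A[n]}) :
  (mwiden p).@[v] = p.@[fun i => v (widen_ord (leqnSn n) i)].
Proof.
rewrite [RHS]mevalE {1}(mpolyE p) (raddf_sum (@mwiden n A)) (raddf_sum (meval v)).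
apply: eq_bigr => m _ /=; rewrite mwidenZ mwidenX mevalZ mevalX; congr (_ * _).
rewrite big_ord_recr /= mnmwiden_ordmax expr0 mulr1.
by apply: eq_bigr => i _; rewrite mnmwiden_widen.
Qed.

Lemma mpoly_eq0 (A : numDomainType) (n : nat) (p : {mpoly A[n]}) :
  (forall v, p.@[v] = 0) -> p = 0.
Proof.
elim: n p => [|n IHn] p p0.
  by have := p0 (fun=> 0); rewrite [p]nvar0_mpolyC mevalC => ->.
suff : muni p = 0 by move=> mp0; rewrite -[p]muniK mp0 rmorph0 horner0.
apply/polyP => k; rewrite coef0; apply: IHn => w.
have := @poly_inj_nonzero _ (map_poly (meval w) (muni p)) 0.
move=> /(_ _)/polyP/(_ k); rewrite coef_map coef0; apply=> x _.
pose v (i : 'I_n.+1) := if insub (val i) is Some j then w j else x.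
rewrite horner0 -(p0 v) -[in RHS](muniK p).
have vx : v ord_max = x by rewrite /v insubF //= ltnn.
have vw j : v (widen_ord (leqnSn n) j) = w j by rewrite /v valK.
rewrite -[in LHS]vx -[in LHS](mevalXU v ord_max).
elim/poly_ind: (muni p) => [|q c IHq]; first by rewrite !rmorph0 !horner0 meval0.
rewrite !rmorphD !rmorphM /= !map_polyX !map_polyC !hornerMXaddC IHq mevalD mevalM.
by rewrite meval_mwiden; congr (_ + _); apply: meval_eq => j.
Qed.

(** If neither factor has degree 0, one of them is linear, g X + d. The last equation says that the
    cubic vanishes at -d/g, multiplied by g^3. *)
Lemma cubic_factor (A : idomainType) (f0 f1 f2 f3 : A) (G H : {poly A}) :
  f3 != 0 ->
  f3%:P * 'X^3 + f2%:P * 'X^2 + f1%:P * 'X + f0%:P = G * H ->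
  [\/ size G = 1%N, size H = 1%N |
      exists g d h, g * h = f3 /\ f0 * g ^+ 3 - f1 * g ^+ 2 * d + f2 * g * d ^+ 2 = f3 * d ^+ 3].
Proof.
move=> f3n0 FE; set F := LHS in FE.
have Fcoef : [/\ F`_0 = f0, F`_1 = f1, F`_2 = f2 & F`_3 = f3].
  by split; rewrite /F !coefE /= ?mulr0 ?mulr1 ?addr0 ?add0r.
have [F0 F1 F2 F3] := Fcoef.
have sF : size F = 4%N.
  apply/eqP; rewrite eqn_leq; apply/andP; split; last first.
    by rewrite ltnNge; apply: contra_neqN f3n0 => /leq_sizeP/(_ 3%N) <-.
  apply/leq_sizeP => -[|[|[|[|j]]]] // _.
  by rewrite /F !coefE /= !mulr0 !addr0.
have F_n0 : F != 0 by rewrite -size_poly_eq0 sF.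
have lin (p q : {poly A}) : F = p * q -> size p = 2%N -> size q = 3%N ->
    exists g d h, g * h = f3 /\
      f0 * g ^+ 3 - f1 * g ^+ 2 * d + f2 * g * d ^+ 2 = f3 * d ^+ 3.
  move=> pq sp sq; exists p`_1, p`_0, q`_2.
  have z (r : {poly A}) n i : size r = n -> (n <= i)%N -> r`_i = 0.
    by move=> <- ?; rewrite nth_default.
  have [p2 p3] := (z p _ 2%N sp isT, z p _ 3%N sp isT).
  have q3 := z q _ 3%N sq isT.
  rewrite -F0 -F1 -F2 -F3 pq !coefM !big_ord_recl !big_ord0 /= /bump /= !subn0 p2 p3 q3.
  by split; ring.
have /andP[Gn0 Hn0] : (G != 0) && (H != 0) by rewrite -negb_or -mulf_eq0 -FE.
have : (size G + size H).-1 = 4%N by rewrite -size_mul // -FE.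
move: (Gn0) (Hn0); rewrite -!size_poly_gt0.
case sG : (size G) => [//|[|[|[|k]]]] _; case sH : (size H) => [//|l] _ /=; rewrite ?addSn.
- by constructor 1.
- by move=> [l2]; constructor 3; apply: (lin G H); rewrite // sH l2.
- by move=> [l1]; constructor 3; apply: (lin H G); rewrite 1?mulrC // sH l1.
- by move=> sum; constructor 2; lia.
Qed.

(** * Factorizations of the restricted polynomials: s is the inner variable, t the outer one *)

Section CharZero.

Variable K : numFieldType.
Implicit Types (G H : {poly {poly K}}).

Let natK (m : nat) : m%:R = (m%:R)%:P :> {poly K}.
Proof. by rewrite polyC_natr. Qed.

Lemma divisor_const (g h : {poly K}) c : c != 0 -> g * h = c%:P ->
  exists2 e, e != 0 & g = e%:P.
Proof.
move=> c0 gh; have : g * h = c *: 'X^0 by rewrite gh expr0 alg_polyC.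
case/(monomial_factor c0) => a [k gE].
have sz : size (a *: 'X^k * h) = 1%N by rewrite -gE gh size_polyC c0.
have a0 : a != 0.
  apply: contraNneq c0 => a0; move: gh; rewrite gE a0 scale0r mul0r => /esym/eqP.
  by rewrite polyC_eq0.
have h0 : h != 0.
  apply: contraNneq c0 => h0; move: gh; rewrite h0 mulr0 => /esym/eqP.
  by rewrite polyC_eq0.
have k0 : k = 0%N.
  move: sz; rewrite size_mul ?scaler_eq0 ?negb_or ?a0 ?expf_neq0 ?polyX_eq0 //.
  rewrite size_scale // size_polyXn; move: h0; rewrite -size_poly_gt0.
  by case: (size h) => // m _; rewrite addSn addnS /= => -[]; case: k {gE}.
by exists a; rewrite // gE k0 expr0 alg_polyC.
Qed.

(** One factor is free of t, so it divides both 8 s^2 and 4 s^2 - 9, hence also 8 s^2 - 2 (4 s^2 -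
    9) = 18. *)
Lemma irreducible_linear G H :
  'X * (#4 * 'X^2 - #9)%:P + (#8 * 'X^2)%:P = G * H ->
  (exists c, G = c%:P%:P) \/ (exists c, H = c%:P%:P).
Proof.
set F := LHS => FE.
have const (p q : {poly {poly K}}) : F = p * q -> size p = 1%N -> exists c, p = c%:P%:P.
  move=> pq /eqP/size_poly1P[g g0 pE].
  have F1 : #4 * 'X^2 - #9 = g * q`_1.
    by rewrite -coefCM -pE -pq /F !coefE /= mul1r addr0.
  have F0 : #8 * 'X^2 = g * q`_0.
    by rewrite -coefCM -pE -pq /F !coefE /= mul0r add0r.
  have : g * (q`_0 - 2 * q`_1) = (18%:R)%:P.
    by rewrite -natK mulrBr mulrCA -F0 -F1; ring.
  case/divisor_const => [|e _ gE]; first by rewrite pnatr_eq0.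
  by exists e; rewrite pE gE.
have f1 : #4 * 'X^2 - #9 != 0 :> {poly K}.
  apply/eqP => /(congr1 (coefp 0)); rewrite !natK /= coefB coefCM coefC coefXn mulr0 sub0r coef0.
  by move/eqP; rewrite oppr_eq0 pnatr_eq0.
have sF : size F = 2%N.
  by rewrite /F mulrC -cons_poly_def size_cons_poly nil_poly polyC_eq0 (negPf f1) size_polyC f1.
have F_n0 : F != 0 by rewrite -size_poly_eq0 sF.
have /andP[Gn0 Hn0] : (G != 0) && (H != 0) by rewrite -negb_or -mulf_eq0 -FE.
have : (size G + size H).-1 = 2%N by rewrite -size_mul // -FE.
move: (Gn0) (Hn0); rewrite -!size_poly_gt0 => sG sH sGH.
have [s1|s1] : size G = 1%N \/ size H = 1%N by lia.
  by left; apply: (const G H).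
by right; apply: (const H G); rewrite // mulrC.
Qed.

Let div_X (p : {poly K}) : p.[0] = 0 -> exists q, p = q * 'X.
Proof. by move=> /eqP/factor_theorem[q ->]; exists q; rewrite subr0. Qed.

(** The leading coefficient 256 is constant, so a factor free of t is constant, and a root would be
    -d/g with g constant. At s = 0 the Newton polygon gives every root the valuation 4/3, which is
    not an integer: d must be divisible by s^2, and dividing the equation by s^4 and setting s = 0
    leaves 27 g^3 = 0. *)
Lemma irreducible_cubic G H :
  (#256)%:P * 'X^3 + (#27 * 'X^4 - #192 * 'X^2)%:P * 'X^2 + (- #6 * 'X^4)%:P * 'X
    + (#27 * 'X^4 - #4 * 'X^6)%:P = G * H ->
  (exists c, G = c%:P%:P) \/ (exists c, H = c%:P%:P).
Proof.
have n256 : #256 != 0 :> {poly K} by rewrite natK polyC_eq0 pnatr_eq0.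
have const (p q : {poly {poly K}}) : (p * q)`_3 = #256 -> size p = 1%N -> exists c, p = c%:P%:P.
  move=> pq /eqP/size_poly1P[g g0 pE]; move: pq; rewrite pE coefCM natK.
  case/divisor_const => [|e _ gE]; first by rewrite pnatr_eq0.
  by exists e; rewrite gE.
move=> FE; case: (cubic_factor n256 FE) => [s1|s1|[g [d [h [gh E]]]]].
- left; apply: (const G H) s1; rewrite -FE !coefE /=; ring.
- by right; apply: (const H G) s1; rewrite mulrC -FE !coefE /=; ring.
exfalso; move: gh; rewrite natK; case/divisor_const => [|e e0 gE].
  by rewrite pnatr_eq0.
have X0 : 'X != 0 :> {poly K} by rewrite polyX_eq0.
have n256K : #256 != 0 :> K by rewrite pnatr_eq0.
have vanish (p : {poly K}) : (#256 * p ^+ 3).[0] = 0 -> exists q, p = q * 'X.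
  rewrite natK hornerM hornerC horner_exp => /eqP; rewrite mulf_eq0 (negPf n256K) /=.
  by rewrite expf_eq0 => /eqP; apply: div_X.
have [d1 d1E] : exists q, d = q * 'X.
  apply: vanish; have -> : #256 * d ^+ 3 = 'X * ('X^3 * (#27 - #4 * 'X^2) * g ^+ 3
      + #6 * 'X^3 * g ^+ 2 * d + (#27 * 'X^3 - #192 * 'X) * g * d ^+ 2).
    by rewrite -E; ring.
  by rewrite hornerM hornerX mul0r.
move: E; rewrite d1E => E.
have {}E : #256 * d1 ^+ 3 =
    'X * ((#27 - #4 * 'X^2) * g ^+ 3 + #6 * 'X * g ^+ 2 * d1
      + (#27 * 'X^2 - #192) * g * d1 ^+ 2).
  apply: (mulfI (expf_neq0 3 X0)); transitivity (#256 * (d1 * 'X) ^+ 3); first by ring.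
  by rewrite -E; ring.
have [d2 d2E] : exists q, d1 = q * 'X.
  by apply: vanish; rewrite E hornerM hornerX mul0r.
move: E; rewrite d2E => E.
have {}E : (#27 - #4 * 'X^2) * g ^+ 3 = 'X * (#256 * 'X * d2 ^+ 3 - #6 * 'X * g ^+ 2 * d2
     - (#27 * 'X^2 - #192) * g * 'X * d2 ^+ 2).
  apply: (mulfI X0); transitivity (#256 * (d2 * 'X) ^+ 3 - 'X * (#6 * 'X * g ^+ 2 * (d2 * 'X)
      + (#27 * 'X^2 - #192) * g * (d2 * 'X) ^+ 2)); last by ring.
  by rewrite E; ring.
have := congr1 (horner^~ 0) E; rewrite /= gE [RHS]hornerM hornerX mul0r.
rewrite hornerM horner_exp hornerC hornerD hornerN hornerM !natK !hornerC hornerXn.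
rewrite expr0n /= mulr0 subr0 => /eqP.
by rewrite mulf_eq0 pnatr_eq0 expf_eq0 (negPf e0).
Qed.

Let size_term (m k n : nat) : (k < n)%N -> (size (m%:R * 'X^k : {poly K})%R <= n)%N.
Proof.
move=> kn; rewrite natK mul_polyC (leq_trans (size_scale_leq _ _)) //.
by rewrite size_polyXn.
Qed.

Let size_add (p q : {poly K}) n :
  (size p <= n)%N -> (size q <= n)%N -> (size (p + q)%R <= n)%N.
Proof. by move=> sp sq; rewrite (leq_trans (size_polyD _ _)) // geq_max sp. Qed.

Let size_sub (p q : {poly K}) n :
  (size p <= n)%N -> (size q <= n)%N -> (size (p - q)%R <= n)%N.
Proof. by move=> sp sq; rewrite size_add // size_polyN. Qed.

Let size_term_eq (m k : nat) : m != 0%N -> size (m%:R * 'X^k : {poly K}) = k.+1.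
Proof. by move=> m0; rewrite natK mul_polyC size_scale ?pnatr_eq0 // size_polyXn. Qed.

(* With respect to the degree in the inner variable, a root -d/g of the cubic  *)
(* would have degree -1/3: the two extreme terms of [E] below have degrees     *)
(* that differ modulo 3, and one of them dominates all the other terms.        *)
Lemma factor_square G H :
  (- (#2304 * 'X^9))%:P * 'X^3 + (#33 * 'X^6 + #5184 * 'X^8)%:P * 'X^2
    + (- (#12 * 'X^3 + #252 * 'X^5 + #4698 * 'X^7))%:P * 'X
    + (#12 * 'X^2 + #228 * 'X^4 + #1944 * 'X^6 + #729 * 'X^8)%:P = G * H ->
  (exists c i, (i <= 2)%N /\ G = (c *: 'X^i)%:P) \/
  (exists c i, (i <= 2)%N /\ H = (c *: 'X^i)%:P).
Proof.
set f3 := - (_ * 'X^9); set f2 := _ + #5184 * 'X^8; set f1 := - _.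
set f0 := _ + #729 * 'X^8 => FE.
have n2304 : #2304 != 0 :> K by rewrite pnatr_eq0.
have f3E : f3 = (- #2304) *: 'X^9 by rewrite /f3 natK mul_polyC scaleNr.
have s3 : size f3 = 10%N by rewrite size_polyN size_term_eq.
have s2 : (size f2 <= 9)%N by rewrite size_add ?size_term.
have s1 : (size f1 <= 8)%N by rewrite size_polyN !size_add ?size_term.
have s0 : size f0 = 9%N.
  by rewrite /f0 addrC size_polyDl size_term_eq // ltnS !size_add ?size_term.
have f3n0 : f3 != 0 by rewrite -size_poly_eq0 s3.
have f0n0 : f0 != 0 by rewrite -size_poly_eq0 s0.
(* A factor free of t divides the leading coefficient -2304 s^9, so it is c s^i; it also divides the
   constant coefficient, whose lowest term is 12 s^2, so i <= 2. *)
have mono (p q : {poly {poly K}}) : (p * q)`_3 = f3 -> (p * q)`_0 = f0 -> size p = 1%N ->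
    exists c i, (i <= 2)%N /\ p = (c *: 'X^i)%:P.
  move=> pq3 pq0 /eqP/size_poly1P[g g0 pE]; move: pq3 pq0; rewrite pE !coefCM f3E.
  case/monomial_factor => [|c [i ->]]; first by rewrite oppr_eq0.
  move=> /(congr1 (coefp 2)); rewrite /= -scalerAl coefZ coefXnM.
  rewrite /f0 !coefD !natK !coefCM !coefXn /= mulr1 !mulr0 !addr0.
  case: ltnP => [_|i2]; last by exists c, i.
  by move/eqP; rewrite mulr0 eq_sym pnatr_eq0.
case: (cubic_factor f3n0 FE) => [sG|sH|[g [d [h [gh E]]]]].
- by left; apply: (mono G H) sG; rewrite -FE !coefE /= ?mulr0 ?mulr1 ?add0r ?addr0.
- right; apply: (mono H G) sH; rewrite mulrC -FE !coefE /= ?mulr0 ?mulr1 ?add0r ?addr0 //.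
exfalso; have g0 : g != 0 by apply: contraNneq f3n0 => g0; rewrite -gh g0 mul0r.
have d0 : d != 0.
  apply: contraNneq (mulf_neq0 f0n0 (expf_neq0 3 g0)) => d0.
  by move: E; rewrite d0 !expr0n /= !mulr0 subr0 addr0 => ->.
have [sg sd] : (0 < size g)%N /\ (0 < size d)%N by rewrite !size_poly_gt0.
have sX (p : {poly K}) k : p != 0 -> size (p ^+ k) = ((size p).-1 * k).+1.
  by move=> p0; rewrite -size_exp prednK // size_poly_gt0 expf_neq0.
have sA : size (f3 * d ^+ 3) = (10 + (size d).-1 * 3)%N.
  by rewrite size_mul ?expf_neq0 // s3 sX // addnS.
have sB : size (f0 * g ^+ 3) = (9 + (size g).-1 * 3)%N.
  by rewrite size_mul ?expf_neq0 // s0 sX // addnS.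
have sC : (size (f1 * g ^+ 2 * d)%R <= 8 + (size g).-1 * 2 + (size d).-1)%N.
  rewrite (leq_trans (size_polyMleq _ _)) //; have := size_polyMleq f1 (g ^+ 2).
  rewrite sX //; move: s1 sg sd.
  by move: (size f1) (size g) (size d) (size (f1 * g ^+ 2)%R); lia.
have sD : (size (f2 * g * d ^+ 2)%R <= 9 + (size g).-1 + (size d).-1 * 2)%N.
  rewrite (leq_trans (size_polyMleq _ _)) //; have := size_polyMleq f2 g.
  rewrite sX //; move: s2 sg sd.
  by move: (size f2) (size g) (size d) (size (f2 * g)%R); lia.
have [dg|gd] := leqP (size g) (size d).
  have : (size (f3 * d ^+ 3)%R < 10 + (size d).-1 * 3)%N.
    rewrite -E ltnS size_add ?size_sub ?sB ?(leq_trans sC) ?(leq_trans sD) //; move: dg sg;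
      move: (size g) (size d); lia.
  by rewrite sA ltnn.
have : (size (f0 * g ^+ 3)%R < 9 + (size g).-1 * 3)%N.
  have -> : f0 * g ^+ 3 = f3 * d ^+ 3 - f2 * g * d ^+ 2 + f1 * g ^+ 2 * d.
    by rewrite -E; ring.
  rewrite ltnS size_add ?size_sub ?sA ?(leq_trans sC) ?(leq_trans sD) //; move: gd sd;
    move: (size g) (size d); lia.
by rewrite sB ltnn.
Qed.

Lemma scale_factor (k : K) (F G H : {poly {poly K}}) : k != 0 ->
  k%:P%:P * F = G * H -> F = (k^-1)%:P%:P * G * H.
Proof. by move=> k0 GH; rewrite -mulrA -GH mulrA -!polyCM mulVf // mul1r. Qed.

Lemma unscale_factor (k : K) (p : {poly K}) G : k != 0 ->
  (k^-1)%:P%:P * G = p%:P -> G = (k *: p)%:P.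
Proof.
by move=> k0 cE; rewrite -mul_polyC polyCM -cE mulrA -!polyCM mulfV // !polyC1 mul1r.
Qed.

Lemma irreducible_slice_I G H (s := 'X%:P) (t := 'X) :
  #15552 * (- #4 * s ^+ 6 + #27 * s ^+ 4 * t ^+ 2 - #6 * s ^+ 4 * t + #27 * s ^+ 4
    - #192 * s ^+ 2 * t ^+ 2 + #256 * t ^+ 3) = G * H ->
  (exists c, G = c%:P%:P) \/ (exists c, H = c%:P%:P).
Proof.
have nE n : n%:R%:P = n%:R :> {poly {poly K}} by rewrite polyC_natr.
have k0 : #15552 != 0 :> K by rewrite pnatr_eq0.
rewrite -nE -(polyC_natr K) => /(scale_factor k0) E.
case: (@irreducible_cubic _ H (etrans _ E)); last by right.
  by rewrite /s /t 2!polyCB !polyCM polyCN !nE; ring.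
case=> c cE; left; exists (#15552 * c).
by rewrite (unscale_factor k0 cE) -mul_polyC polyCM.
Qed.

Lemma factor_slice_L G H (s := 'X%:P) (t := 'X) :
  #4096 * (- #2304 * s ^+ 9 * t ^+ 3 + #5184 * s ^+ 8 * t ^+ 2 + #729 * s ^+ 8
    - #4698 * s ^+ 7 * t + #33 * s ^+ 6 * t ^+ 2 + #1944 * s ^+ 6 - #252 * s ^+ 5 * t
    + #228 * s ^+ 4 - #12 * s ^+ 3 * t + #12 * s ^+ 2) = G * H ->
  (exists c i, (i <= 2)%N /\ G = (c *: 'X^i)%:P) \/
  (exists c i, (i <= 2)%N /\ H = (c *: 'X^i)%:P).
Proof.
have nE n : n%:R%:P = n%:R :> {poly {poly K}} by rewrite polyC_natr.
have k0 : #4096 != 0 :> K by rewrite pnatr_eq0.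
rewrite -nE -(polyC_natr K) => /(scale_factor k0) E.
case: (@factor_square _ H (etrans _ E)); last by right.
  by rewrite /s /t 2!polyCN 6!polyCD !polyCM !nE; ring.
case=> c [i [i2 cE]]; left; exists (#4096 * c), i; split=> //.
by rewrite (unscale_factor k0 cE) scalerA.
Qed.

End CharZero.

Lemma rmorph_mmap (n : nat) (K : nzRingType) (A B : comNzRingType) (phi : {rmorphism A -> B})
    (f : K -> A) (f' : K -> B) (h : 'I_n -> A) (h' : 'I_n -> B) (p : {mpoly K[n]}) :
  phi \o f =1 f' -> phi \o h =1 h' -> phi (mmap f h p) = mmap f' h' p.
Proof.
move=> ff hh; rewrite /mmap rmorph_sum; apply: eq_bigr => m _.
rewrite rmorphM -ff; congr (_ * _); rewrite /mmap1 rmorph_prod.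
by apply: eq_bigr => i _; rewrite rmorphXn -hh.
Qed.

Lemma monomial_cancel (A : idomainType) (p q : A) (r : {poly A}) (M N : nat) :
  p != 0 -> p%:P * 'X^M * r = (p * q)%:P * 'X^(M + N) -> r = q%:P * 'X^N.
Proof.
move=> p0; rewrite polyCM exprD mulrACA => /mulfI -> //.
by rewrite mulf_neq0 ?polyC_eq0 // expf_neq0 ?polyX_eq0.
Qed.

Lemma monomial_degree (A : idomainType) (p q : A) (k l N : nat) :
  p * q != 0 -> p%:P * 'X^k * (q%:P * 'X^l) = (p * q)%:P * 'X^N -> (k + l)%N = N.
Proof.
move=> pq0; rewrite mulrACA -polyCM -exprD => /mulfI E.
have /(congr1 (fun r : {poly A} => size r)) : 'X^(k + l) = 'X^N :> {poly A}.
  by apply: E; rewrite polyC_eq0.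
by rewrite !size_polyXn => -[].
Qed.

(** * Complex coordinates and formal conjugates *)

Section Conjugates.

Context {R : realType}.
Implicit Types (A B : comNzRingType).

(* The point of A^n whose pairs of coordinates (t_(2k), t_(2k+1)) satisfy      *)
(* t_(2k) + i t_(2k+1) = al_k and t_(2k) - i t_(2k+1) = be_k.                 *)
Definition point A (iota : R[i] -> A) (al be : nat -> A) (j : nat) : A :=
  if odd j then iota (- ('i / 2)) * (al j./2 - be j./2)
  else iota 2^-1 * (al j./2 + be j./2).

(** The target is any commutative C-algebra, so that evaluation at numbers, exchange of [al] and
    [be], weights and restriction to slices are all instances. *)
Definition cev n A (iota : {rmorphism R[i] -> A}) (al be : nat -> A)
    (p : {mpoly R[i][n]}) : A :=
  mmap iota (fun j : 'I_n => point iota al be j) p.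

HB.instance Definition _ n A iota al be :=
  GRing.RMorphism.copy (@cev n A iota al be)
    (mmap iota (fun j : 'I_n => point iota al be j)).

Lemma rmorph_point A B (phi : {rmorphism A -> B}) (iota : R[i] -> A) al be j :
  phi (point iota al be j) = point (phi \o iota) (phi \o al) (phi \o be) j.
Proof. by rewrite /point; case: ifP; rewrite rmorphM ?rmorphB ?rmorphD. Qed.

Lemma half_i A (iota : {rmorphism R[i] -> A}) :
  iota 2^-1 * (1 + 1) = 1 /\ iota 'i * iota 'i = -1.
Proof.
split; last by rewrite -rmorphM -expr2 sqr_i rmorphN1.
by rewrite -(rmorph1 iota) -rmorphD -rmorphM mulVf // pnatr_eq0.
Qed.

Section Coordinates.

Variable n : nat.
Hypothesis n_odd : odd n.

(** The number [n.+1] of real coordinates is even, so they form complete pairs; the bound on k keeps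
    [inord] away from its default value. *)
Lemma ltn_pair (k : nat) : (k.*2 < n.+1)%N = (k.*2.+1 < n.+1)%N.
Proof.
rewrite !ltnS leq_eqVlt; case: eqP => //= kn.
by move: n_odd; rewrite -kn odd_double.
Qed.

Lemma ltn_half_pair (j : 'I_n.+1) : (j./2.*2.+1 < n.+1)%N.
Proof.
rewrite -ltn_pair (leq_ltn_trans _ (ltn_ord j)) //.
by rewrite -[X in (_ <= X)%N]odd_double_half leq_addl.
Qed.

Lemma eq_point A (iota iota' : R[i] -> A) al be al' be' (j : 'I_n.+1) :
  iota =1 iota' ->
  (forall k, (k.*2.+1 < n.+1)%N -> al k = al' k) ->
  (forall k, (k.*2.+1 < n.+1)%N -> be k = be' k) ->
  point iota al be j = point iota' al' be' j.
Proof.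
by move=> ii aa bb; rewrite /point !ii aa ?bb // ltn_half_pair.
Qed.

Definition holo A (iota : R[i] -> A) (x : 'I_n.+1 -> A) (k : nat) : A :=
  x (inord k.*2) + iota 'i * x (inord k.*2.+1).
Definition anti A (iota : R[i] -> A) (x : 'I_n.+1 -> A) (k : nat) : A :=
  x (inord k.*2) - iota 'i * x (inord k.*2.+1).

Lemma point_holo A (iota : {rmorphism R[i] -> A}) (x : 'I_n.+1 -> A) (j : 'I_n.+1) :
  point iota (holo iota x) (anti iota x) j = x j.
Proof.
have [i2 ii] := half_i iota.
rewrite /point /holo /anti.
have inj k : k = j :> nat -> inord k = j by move=> ->; rewrite inord_val.
case: ifP => jo; set h := iota 2^-1 in i2 *; last first.
  have -> : inord j./2.*2 = j by apply: inj; rewrite -[RHS]odd_double_half jo.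
  set z := x (inord _).
  by transitivity (h * (1 + 1) * x j); [ring | rewrite i2 mul1r].
have -> : inord j./2.*2.+1 = j by apply: inj; rewrite -[RHS]odd_double_half jo.
rewrite rmorphN rmorphM -/h.
set u := iota 'i in ii *; set y := x (inord _).
by transitivity (- (u * u) * (h * (1 + 1)) * x j); [ring | rewrite ii i2; ring].
Qed.

Lemma holo_point A (iota : {rmorphism R[i] -> A}) (al be : nat -> A) (k : nat) :
  (k.*2.+1 < n.+1)%N ->
  holo iota (fun j => point iota al be j) k = al k.
Proof.
move=> kn; have [i2 ii] := half_i iota.
rewrite /holo /point !inordK ?ltn_pair //= odd_double /= uphalf_double doubleK.
rewrite rmorphN rmorphM; set h := iota 2^-1 in i2 *; set u := iota 'i in ii *.
transitivity (h * (al k + be k) - (u * u) * (h * (al k - be k))); first by ring.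
by rewrite ii; transitivity (h * (1 + 1) * al k); [ring | rewrite i2 mul1r].
Qed.

Lemma anti_point A (iota : {rmorphism R[i] -> A}) (al be : nat -> A) (k : nat) :
  (k.*2.+1 < n.+1)%N ->
  anti iota (fun j => point iota al be j) k = be k.
Proof.
move=> kn; have [i2 ii] := half_i iota.
rewrite /anti /point !inordK ?ltn_pair //= odd_double /= uphalf_double doubleK.
rewrite rmorphN rmorphM; set h := iota 2^-1 in i2 *; set u := iota 'i in ii *.
transitivity (h * (al k + be k) + (u * u) * (h * (al k - be k))); first by ring.
by rewrite ii; transitivity (h * (1 + 1) * be k); [ring | rewrite i2 mul1r].
Qed.

Definition zvar : nat -> {mpoly R[i][n.+1]} := holo (@mpolyC n.+1 R[i]) (fun j => 'X_j).
Definition zbar : nat -> {mpoly R[i][n.+1]} := anti (@mpolyC n.+1 R[i]) (fun j => 'X_j).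

Lemma cevX A (iota : {rmorphism R[i] -> A}) al be (j : 'I_n.+1) :
  cev iota al be 'X_j = point iota al be j.
Proof. by rewrite /cev mmapX mmap1U. Qed.

Lemma cevC A (iota : {rmorphism R[i] -> A}) al be c :
  cev iota al be (c%:MP : {mpoly R[i][n.+1]}) = iota c.
Proof. by rewrite /cev mmapC. Qed.

Lemma cev_zvar A (iota : {rmorphism R[i] -> A}) al be (k : nat) :
  (k.*2.+1 < n.+1)%N -> cev iota al be (zvar k) = al k.
Proof.
move=> kn; rewrite /zvar /holo rmorphD rmorphM /= !cevX cevC.
exact: (holo_point iota al be kn).
Qed.

Lemma cev_zbar A (iota : {rmorphism R[i] -> A}) al be (k : nat) :
  (k.*2.+1 < n.+1)%N -> cev iota al be (zbar k) = be k.
Proof.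
move=> kn; rewrite /zbar /anti rmorphB rmorphM /= !cevX cevC.
exact: (anti_point iota al be kn).
Qed.

Lemma rmorph_cev A B (phi : {rmorphism A -> B}) (iota : {rmorphism R[i] -> A})
    (iota' : {rmorphism R[i] -> B}) al be al' be' (p : {mpoly R[i][n.+1]}) :
  phi \o iota =1 iota' ->
  (forall k, (k.*2.+1 < n.+1)%N -> phi (al k) = al' k) ->
  (forall k, (k.*2.+1 < n.+1)%N -> phi (be k) = be' k) ->
  phi (cev iota al be p) = cev iota' al' be' p.
Proof.
move=> ii aa bb; apply: rmorph_mmap => // j /=.
by rewrite rmorph_point; apply: eq_point.
Qed.

Lemma eq_cev A (iota : {rmorphism R[i] -> A}) al be al' be' (p : {mpoly R[i][n.+1]}) :
  (forall k, (k.*2.+1 < n.+1)%N -> al k = al' k) ->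
  (forall k, (k.*2.+1 < n.+1)%N -> be k = be' k) ->
  cev iota al be p = cev iota al' be' p.
Proof. by move=> aa bb; apply: (rmorph_cev (phi := idfun)). Qed.

Definition pev (al be : nat -> R[i]) (p : {mpoly R[i][n.+1]}) : R[i] := cev idfun al be p.

HB.instance Definition _ al be :=
  GRing.RMorphism.copy (pev al be) (cev idfun al be).

Lemma pev_eq (p q : {mpoly R[i][n.+1]}) :
  (forall al be, pev al be p = pev al be q) -> p = q.
Proof.
move=> pq; apply/eqP; rewrite -subr_eq0; apply/eqP/mpoly_eq0 => v.
have := pq (holo idfun v) (anti idfun v).
have E r : pev (holo idfun v) (anti idfun v) r = r.@[v].
  by apply: (rmorph_mmap (phi := idfun)) => // j; exact: (point_holo idfun).
by rewrite !E mevalB => ->; rewrite subrr.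
Qed.

Definition swap (p : {mpoly R[i][n.+1]}) : {mpoly R[i][n.+1]} :=
  cev (@mpolyC n.+1 R[i]) zbar zvar p.

HB.instance Definition _ := GRing.RMorphism.copy swap (cev (@mpolyC n.+1 R[i]) zbar zvar).

Lemma cev_swap A (iota : {rmorphism R[i] -> A}) al be p :
  cev iota al be (swap p) = cev iota be al p.
Proof.
apply: rmorph_cev => [c|k kn|k kn]; first exact: cevC.
  exact: cev_zbar.
exact: cev_zvar.
Qed.

(** A one-parameter torus action, with the parameter as a polynomial variable. Weights (1, 0) give
    the degree in [al], weights (0, 1) the degree in [be]. *)
Definition weigh (wa wb : nat -> nat) (p : {mpoly R[i][n.+1]}) :
    {poly {mpoly R[i][n.+1]}} :=
  cev (polyC \o @mpolyC n.+1 R[i]) (fun k => (zvar k)%:P * 'X^(wa k))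
    (fun k => (zbar k)%:P * 'X^(wb k)) p.

HB.instance Definition _ wa wb := GRing.RMorphism.copy (weigh wa wb)
  (cev (polyC \o @mpolyC n.+1 R[i]) (fun k => (zvar k)%:P * 'X^(wa k))
    (fun k => (zbar k)%:P * 'X^(wb k))).

Definition whomog wa wb N (p : {mpoly R[i][n.+1]}) := weigh wa wb p = p%:P * 'X^N.

Lemma pev_weigh wa wb al be l p :
  pev al be (weigh wa wb p).[l%:MP] =
  pev (fun k => al k * l ^+ wa k) (fun k => be k * l ^+ wb k) p.
Proof.
pose phi := pev al be \o horner_eval (l%:MP_[n.+1]).
rewrite -[LHS]/(phi (weigh wa wb p)).
apply: rmorph_cev => [c|k kn|k kn] /=; rewrite /horner_eval.
- by rewrite hornerC [pev _ _ _]cevC.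
- by rewrite hornerM hornerC hornerXn rmorphM rmorphXn /= [pev _ _ l%:MP]cevC [pev _ _ _]cev_zvar.
- by rewrite hornerM hornerC hornerXn rmorphM rmorphXn /= [pev _ _ l%:MP]cevC [pev _ _ _]cev_zbar.
Qed.

Lemma whomog_pev wa wb N p : whomog wa wb N p -> forall al be l,
  pev (fun k => al k * l ^+ wa k) (fun k => be k * l ^+ wb k) p = pev al be p * l ^+ N.
Proof.
move=> pN al be l; rewrite -pev_weigh pN hornerM hornerC hornerXn rmorphM rmorphXn /=.
by rewrite [pev _ _ l%:MP]cevC.
Qed.

Lemma whomogM_cancel wa wb M N p q : p != 0 ->
  whomog wa wb M p -> whomog wa wb (M + N) (p * q) -> whomog wa wb N q.
Proof.
rewrite /whomog => p0 pM; rewrite rmorphM /= pM.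
exact: monomial_cancel.
Qed.

(** [weigh] is a ring morphism, so the images of p and q multiply to a monomial and are monomials
    themselves. Setting the parameter to 1 identifies their coefficients with p and q. *)
Lemma whomog_factor wa wb N p q : p * q != 0 -> whomog wa wb N (p * q) ->
  exists a b, [/\ (a + b)%N = N, whomog wa wb a p & whomog wa wb b q].
Proof.
move=> pq0 pqN.
have weigh1 r : (weigh wa wb r).[1] = r.
  apply: pev_eq => al be; rewrite -[1](mpolyC1) pev_weigh.
  by apply: eq_cev => k _; rewrite expr1n mulr1.
have mono r a k : weigh wa wb r = a *: 'X^k -> whomog wa wb k r.
  move=> rE; have := weigh1 r; rewrite rE hornerZ hornerXn expr1n mulr1 => ar.
  by rewrite /whomog rE ar mul_polyC.
have pqE : weigh wa wb p * weigh wa wb q = (p * q) *: 'X^N.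
  by rewrite -mul_polyC -pqN [RHS]rmorphM.
have [a [k /mono pk]] := monomial_factor pq0 pqE.
have [b [l /mono ql]] : exists b l, weigh wa wb q = b *: 'X^l.
  by move: pqE; rewrite mulrC; apply: monomial_factor.
exists k, l; split=> //; apply: (monomial_degree pq0).
by rewrite -pk -ql pqE mul_polyC.
Qed.

Section Slice.

Variables v0 v1 v2 be0 : nat -> R[i].

Definition slice (p : {mpoly R[i][n.+1]}) : {poly {poly R[i]}} :=
  cev (polyC \o polyC)
    (fun k => (v0 k)%:P%:P + 'X%:P * (v1 k)%:P%:P + 'X * (v2 k)%:P%:P)
    (fun k => (be0 k)%:P%:P) p.

HB.instance Definition _ := GRing.RMorphism.copy slice
  (cev (polyC \o polyC)
    (fun k => (v0 k)%:P%:P + 'X%:P * (v1 k)%:P%:P + 'X * (v2 k)%:P%:P)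
    (fun k => (be0 k)%:P%:P)).

Lemma horner_slice p s t :
  (slice p).[t%:P].[s] = pev (fun k => v0 k + s * v1 k + t * v2 k) be0 p.
Proof.
pose phi := horner_eval s \o horner_eval t%:P.
rewrite -[LHS]/(phi (slice p)).
by apply: rmorph_cev => [c|k kn|k kn] /=; rewrite /horner_eval !hornerE.
Qed.

(* If [p] restricts to [c s^i] on the affine plane v0 + s v1 + t v2, then      *)
(* homogeneity forces [p = c s^i] on the plane at infinity, and [i] is the     *)
(* degree of [p] as soon as [p] is not identically zero there.                 *)
Lemma slice_monomial a p c i s0 t0 :
  whomog (fun=> 1%N) (fun=> 0%N) a p -> slice p = (c *: 'X^i)%:P ->
  pev (fun k => s0 * v1 k + t0 * v2 k) be0 p != 0 ->
  a = i /\ forall s t, pev (fun k => s * v1 k + t * v2 k) be0 p = c * s ^+ i.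
Proof.
move=> pa pE p0.
(* The homogenization l |-> p(l v0 + s v1 + t v2): for l != 0 it is l^a times the value of p on the
   slice at (s/l, t/l), and at l = 0 it is the value at infinity. *)
pose q s t : {poly R[i]} := cev (@polyC R[i])
  (fun k => 'X * (v0 k)%:P + (s * v1 k + t * v2 k)%:P) (fun k => (be0 k)%:P) p.
have qE s t l : (q s t).[l] = pev (fun k => l * v0 k + (s * v1 k + t * v2 k)) be0 p.
  pose phi : {rmorphism _ -> _} := horner_eval l.
  by apply: (rmorph_cev (phi := phi)) => [d|k kn|k kn] /=; rewrite /horner_eval !hornerE.
have q0 s t : (q s t)`_0 = pev (fun k => s * v1 k + t * v2 k) be0 p.
  by rewrite -horner_coef0 qE; apply: eq_cev => k _; rewrite ?mul0r ?add0r.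
have qX s t : 'X^i * q s t = (c * s ^+ i) *: 'X^a.
  apply: poly_inj_nonzero => l l0; rewrite hornerM qE hornerZ !hornerXn.
  have := whomog_pev pa (fun k => v0 k + (s / l) * v1 k + (t / l) * v2 k) be0 l.
  rewrite -horner_slice pE hornerC hornerZ hornerXn => H.
  transitivity (l ^+ i * (c * (s / l) ^+ i * l ^+ a)).
    congr (_ * _); rewrite -H; apply: eq_cev => k _; last by rewrite expr0 mulr1.
    by rewrite expr1; field.
  by rewrite expr_div_n; field; rewrite expf_neq0.
(* Comparing coefficients of degree i, the value at infinity is zero unless i = a. *)
have qi s t : (q s t)`_0 = c * s ^+ i * (i == a)%:R.
  by have := congr1 (coefp i) (qX s t); rewrite /= coefXnM ltnn subnn coefZ coefXn.
have ia : i = a.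
  by move: p0; rewrite -q0 qi; case: (i =P a) => // _; rewrite mulr0 eqxx.
by split=> // s t; rewrite -q0 qi ia eqxx mulr1.
Qed.

End Slice.

End Coordinates.
End Conjugates.

(** * From natural polynomial expressions to polynomials with real coefficients *)

Section FormalPolynomial.

Context {R : realType}.
Variable n : nat.
Hypothesis n_odd : odd n.
Variables (Phi : forall A : comNzRingType, A -> (nat -> A) -> (nat -> A) -> A) (c : R[i]) (N : nat).

Hypothesis Phi_morph : forall (A B : comNzRingType) (phi : {rmorphism A -> B}) h al be al' be',
  (forall k, (k.*2.+1 < n.+1)%N -> phi (al k) = al' k) ->
  (forall k, (k.*2.+1 < n.+1)%N -> phi (be k) = be' k) ->
  phi (Phi h al be) = Phi (phi h) al' be'.
Hypothesis Phi_sym : forall (A : comNzRingType) (h : A) al be, Phi h al be = Phi h be al.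
Hypothesis Phi_homog : forall (A : comNzRingType) (h l : A) al be,
  Phi h (fun k => al k * l ^+ 1) (fun k => be k * l ^+ 0) = Phi h al be * l ^+ N.
Hypothesis c_real : conjc c = c.

(** The value of [Phi] at the generic point. As [Phi] commutes with ring morphisms, all its other
    values are obtained from this one by evaluation. *)
Definition formal : {mpoly R[i][n.+1]} := Phi c%:MP (@zvar R n) (@zbar R n).

Lemma cev_formal (A : comNzRingType) (iota : {rmorphism R[i] -> A}) al be :
  cev iota al be formal = Phi (iota c) al be.
Proof.
rewrite /formal (@Phi_morph _ _ (cev iota al be) _ _ _ al be (@cev_zvar R n n_odd A iota al be)
  (@cev_zbar R n n_odd A iota al be)).
by congr Phi; apply: cevC.
Qed.

Lemma swap_formal : swap formal = formal.
Proof. by rewrite [LHS]cev_formal Phi_sym. Qed.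

Lemma formal_weigh wa wb M :
  (forall (A : comNzRingType) (h l : A) al be,
    Phi h (fun k => al k * l ^+ wa k) (fun k => be k * l ^+ wb k) = Phi h al be * l ^+ M) ->
  whomog wa wb M formal.
Proof.
move=> PhiM; rewrite /whomog [LHS]cev_formal PhiM; congr (_ * _).
by rewrite /formal (@Phi_morph _ _ _ _ _ _ (polyC \o @zvar R n) (polyC \o @zbar R n)).
Qed.

Lemma formal_homog : whomog (fun=> 1%N) (fun=> 0%N) N formal.
Proof. exact: formal_weigh. Qed.

(** Conjugating coefficients exchanges [zvar] and [zbar]; since [Phi] is symmetric and [c] is real,
    the polynomial is fixed, so its coefficients are real. *)
Lemma formal_real : exists p : {mpoly R[n.+1]}, map_mpoly (real_complex R) p = formal.
Proof.
have conjF : map_mpoly (@conjc R) formal = formal.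
  rewrite -[RHS]swap_formal [RHS]cev_formal /formal.
  have conj_i : conjc 'i = - 'i :> R[i] by apply/eqP; rewrite eq_complex /= oppr0 !eqxx.
  have mapi : map_mpoly (@conjc R) 'i%:MP_[n.+1] = - 'i%:MP_[n.+1].
    by rewrite [LHS]map_mpolyC [X in X%:MP_[_]]conj_i rmorphN.
  have zvarJ k : map_mpoly (@conjc R) (@zvar R n k) = @zbar R n k.
    by rewrite /zvar /zbar /holo /anti rmorphD rmorphM /= !map_mpolyX mapi mulNr.
  have zbarJ k : map_mpoly (@conjc R) (@zbar R n k) = @zvar R n k.
    rewrite /zvar /zbar /holo /anti rmorphB rmorphM /= !map_mpolyX mapi mulNr.
    by rewrite opprK.
  rewrite (@Phi_morph _ _ (map_mpoly (@conjc R)) _ _ _ (@zbar R n) (@zvar R n)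
    (fun k _ => zvarJ k) (fun k _ => zbarJ k)).
  by congr Phi; rewrite [LHS]map_mpolyC [X in X%:MP_[_]]c_real.
have realF m : formal@_m = (complex.Re formal@_m)%:C.
  have := congr1 (mcoeff m) conjF; rewrite mcoeff_map_mpoly.
  case: formal@_m => a b /= [] /eqP; rewrite eq_sym -addr_eq0 -mulr2n mulrn_eq0 /= => /eqP ->.
  by [].
exists (\sum_(m <- msupp formal) complex.Re formal@_m *: 'X_[m]).
rewrite rmorph_sum [RHS]mpolyE; apply: eq_bigr => m _ /=.
by rewrite map_mpolyZ map_mpolyX; congr (_ *: _); rewrite [RHS]realF.
Qed.

Lemma meval_real_complex (p : {mpoly R[n.+1]}) (t : 'I_n.+1 -> R) :
  map_mpoly (real_complex R) p = formal ->
  (p.@[t])%:C = Phi c (ccoord t) (fun k => conjc (ccoord t k)).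
Proof.
move=> pF; rewrite -[c]/(idfun c) -(cev_formal idfun) -pF.
rewrite -[LHS]/(real_complex R (p.@[t])) {1}/meval.
rewrite (rmorph_mmap (f' := real_complex R) (h' := fun i => (t i)%:C)) //.
rewrite /cev /map_mpoly.
rewrite (rmorph_mmap (f' := real_complex R)
  (h' := fun j : 'I_n.+1 => point idfun (ccoord t) (fun k => (ccoord t k)^*) j)) //.
- have E (i : 'I_n.+1) : (t i)%:C = point idfun (ccoord t) (fun k => (ccoord t k)^*) i.
    rewrite -[LHS](point_holo idfun (fun i => (t i)%:C)).
    apply: eq_point => // k _; rewrite [RHS]complexE /holo /anti /ccoord //=.
    by rewrite rmorphN mulrN.
  by rewrite /mmap; apply: eq_bigr => m _; congr (_ * _); apply: mmap1_eq.
- by move=> r /=; rewrite mmapC.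
- by move=> i /=; rewrite mmapX mmap1U.
Qed.

End FormalPolynomial.

(** * The polarizations of P and P1 *)

(* [P] as a polynomial in the traces; [h] stands for 1/288. *)
Definition traceP (A : comNzRingType) (h i1 i2 i4 a2 b2 a3 b3 c d : A) : A :=
  let e := b2 * c ^+ 2 + a2 * d ^+ 2 in
  let f := b2 * a3 * d + a2 * b3 * c in
  \sum_(k < 7) \sum_(l < 5)
    pcoef i1 i2 i4 (#32 * h * (a3 * b3)) (#24 * h * (3 * e + f))
      (#24 * h * (3 * e - f)) (#12 * h * (a2 ^+ 2 * b3 * d + b2 ^+ 2 * a3 * c))
      (#2 * h * (a3 ^+ 2 * b2 ^+ 3 + b3 ^+ 2 * a2 ^+ 3))
      (h * (a2 ^+ 4 * b3 ^+ 2 * d ^+ 2 + b2 ^+ 4 * a3 ^+ 2 * c ^+ 2)) k l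
    * (#72 * h * (a2 * b2)) ^+ k * (c * d) ^+ l.

(** X and Y are independent here; P is recovered at Y = X^* and h = 1/288 ([P_polarP]). *)
Definition polarP (A : comNzRingType) (h : A) (X Y : 'M[A]_3) : A :=
  traceP h (\tr (X * Y)) (\tr (X ^+ 2 * Y ^+ 2)) (\tr (X * Y * X ^+ 2 * Y ^+ 2))
    (\tr (X ^+ 2)) (\tr (Y ^+ 2)) (\tr (X ^+ 3)) (\tr (Y ^+ 3))
    (\tr (X ^+ 2 * Y)) (\tr (X * Y ^+ 2)).

Lemma rmorph_pcoef (A B : comNzRingType) (phi : {rmorphism A -> B})
    (i1 i2 i4 i5 i7 i8 i11 i13 i16 : A) k l :
  phi (pcoef i1 i2 i4 i5 i7 i8 i11 i13 i16 k l) =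
  pcoef (phi i1) (phi i2) (phi i4) (phi i5) (phi i7) (phi i8) (phi i11) (phi i13)
    (phi i16) k l.
Proof.
unfold pcoef.
case: k => [|[|[|[|[|[|[|k]]]]]]]; case: l => [|[|[|[|[|l]]]]]; ring.
Qed.

Lemma rmorph_traceP (A B : comNzRingType) (phi : {rmorphism A -> B})
    (h i1 i2 i4 a2 b2 a3 b3 c d : A) :
  phi (traceP h i1 i2 i4 a2 b2 a3 b3 c d) =
  traceP (phi h) (phi i1) (phi i2) (phi i4) (phi a2) (phi b2) (phi a3) (phi b3)
    (phi c) (phi d).
Proof.
rewrite /traceP rmorph_sum; apply: eq_bigr => k _; rewrite rmorph_sum.
apply: eq_bigr => l _; rewrite !rmorphM !rmorphXn rmorph_pcoef.
by rewrite !(rmorphN, rmorphD, rmorphM, rmorphXn, rmorph_nat).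
Qed.

Lemma rmorph_polarP (A B : comNzRingType) (phi : {rmorphism A -> B}) (h : A) (X Y : 'M[A]_3) :
  phi (polarP h X Y) = polarP (phi h) (map_mx phi X) (map_mx phi Y).
Proof.
by rewrite /polarP rmorph_traceP -!trace_map_mx !(rmorphM, rmorphXn).
Qed.

Lemma traceP_swap (A : comNzRingType) (h i1 i2 i4 a2 b2 a3 b3 c d : A) :
  traceP h i1 i2 i4 b2 a2 b3 a3 d c = traceP h i1 i2 i4 a2 b2 a3 b3 c d.
Proof.
rewrite {1}/traceP (mulrC b3 a3) (mulrC b2 a2) (mulrC d c) (addrC (a2 * d ^+ 2)).
rewrite (addrC (a2 * b3 * c)) (addrC (b2 ^+ 2 * a3 * c)) (addrC (b3 ^+ 2 * a2 ^+ 3)).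
by rewrite (addrC (b2 ^+ 4 * a3 ^+ 2 * c ^+ 2)).
Qed.

(** Transposition reverses words: it exchanges the roles of X and Y in the other traces, and fixes
    tr(XYX^2Y^2) up to a cyclic rotation. *)
Lemma polarP_swap (A : comNzRingType) (h : A) (X Y : 'M[A]_3) :
  polarP h Y^T X^T = polarP h X Y.
Proof.
have trM (U V : 'M[A]_3) : U^T * V^T = (V * U)^T by rewrite -!mulmxE trmx_mul.
have trX (U : 'M[A]_3) m : U^T ^+ m = (U ^+ m)^T.
  by elim: m => [|m IHm]; rewrite ?expr0 ?trmx1 // exprS IHm trM -exprSr.
rewrite /polarP !trX !trM !mxtrace_tr.
have -> : \tr (X ^+ 2 * (Y ^+ 2 * (X * Y))) = \tr (X * Y * X ^+ 2 * Y ^+ 2).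
  by rewrite mulrA -[in LHS]mulmxE mxtrace_mulC !mulmxE !mulrA.
exact: traceP_swap.
Qed.

Lemma traceP_homog (A : comNzRingType) (h i1 i2 i4 a2 b2 a3 b3 c d l m : A) :
  traceP h (l * m * i1) (l ^+ 2 * m ^+ 2 * i2) (l ^+ 3 * m ^+ 3 * i4) (l ^+ 2 * a2)
    (m ^+ 2 * b2) (l ^+ 3 * a3) (m ^+ 3 * b3) (l ^+ 2 * m * c) (l * m ^+ 2 * d) =
  l ^+ 12 * m ^+ 12 * traceP h i1 i2 i4 a2 b2 a3 b3 c d.
Proof.
rewrite /traceP !mulr_sumr; apply: eq_bigr => -[k kP] _; rewrite !mulr_sumr.
apply: eq_bigr => -[j jP] _ /=; unfold pcoef.
by case: k kP => [|[|[|[|[|[|[|k]]]]]]] //; case: j jP => [|[|[|[|[|j]]]]] // *; ring.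
Qed.

Lemma matrix3_mul (A : comNzRingType) (a b c d e f g h i a' b' c' d' e' f' g' h' i' : A) :
  matrix3 [:: [:: a; b; c]; [:: d; e; f]; [:: g; h; i]] *
  matrix3 [:: [:: a'; b'; c']; [:: d'; e'; f']; [:: g'; h'; i']] =
  matrix3 [::
    [:: a * a' + b * d' + c * g'; a * b' + b * e' + c * h'; a * c' + b * f' + c * i'];
    [:: d * a' + e * d' + f * g'; d * b' + e * e' + f * h'; d * c' + e * f' + f * i'];
    [:: g * a' + h * d' + i * g'; g * b' + h * e' + i * h'; g * c' + h * f' + i * i']].
Proof.
apply/matrixP => j k; rewrite !mxE !big_ord_recl big_ord0 !mxE /= addr0 !addrA.
by case: j => [[|[|[|j]]] jP] //; case: k => [[|[|[|k]]] kP].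
Qed.

Lemma matrix3_trace (A : comNzRingType) (a b c d e f g h i : A) :
  \tr (matrix3 [:: [:: a; b; c]; [:: d; e; f]; [:: g; h; i]]) = a + e + i.
Proof. by rewrite /mxtrace !big_ord_recl big_ord0 !mxE /= addr0 addrA. Qed.

Lemma matrix3_tr (A : comNzRingType) (a b c d e f g h i : A) :
  (matrix3 [:: [:: a; b; c]; [:: d; e; f]; [:: g; h; i]])^T =
  matrix3 [:: [:: a; d; g]; [:: b; e; h]; [:: c; f; i]].
Proof.
apply/matrixP => j k; rewrite !mxE.
by case: j => [[|[|[|j]]] jP] //; case: k => [[|[|[|k]]] kP].
Qed.

Lemma map_matrix3 (A B : comNzRingType) (phi : {rmorphism A -> B}) (a b c d e f g h i : A) :
  map_mx phi (matrix3 [:: [:: a; b; c]; [:: d; e; f]; [:: g; h; i]]) =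
  matrix3 [:: [:: phi a; phi b; phi c]; [:: phi d; phi e; phi f]; [:: phi g; phi h; phi i]].
Proof.
apply/matrixP => j k; rewrite !mxE.
by case: j => [[|[|[|j]]] jP] //; case: k => [[|[|[|k]]] kP].
Qed.

(** The constants in [traceP] are 288 times the normalizing factors of the invariants, where a real
    part contributes a further factor 1/2. *)
Lemma traceP_values (A : comNzRingType) (h i1 i2 i4 a2 b2 a3 b3 c d : A)
    (i3 i5 i6 i7 i8 i11 i13 i16 : A) :
  #288 * h = 1 ->
  a2 * b2 = #4 * i3 -> a3 * b3 = #9 * i5 -> c * d = i6 ->
  3 * (b2 * c ^+ 2 + a2 * d ^+ 2) + (b2 * a3 * d + a2 * b3 * c) = #12 * i7 ->
  3 * (b2 * c ^+ 2 + a2 * d ^+ 2) - (b2 * a3 * d + a2 * b3 * c) = #12 * i8 ->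
  a2 ^+ 2 * b3 * d + b2 ^+ 2 * a3 * c = #24 * i11 ->
  a3 ^+ 2 * b2 ^+ 3 + b3 ^+ 2 * a2 ^+ 3 = #144 * i13 ->
  a2 ^+ 4 * b3 ^+ 2 * d ^+ 2 + b2 ^+ 4 * a3 ^+ 2 * c ^+ 2 = #288 * i16 ->
  traceP h i1 i2 i4 a2 b2 a3 b3 c d =
  \sum_(k < 7) \sum_(l < 5)
    pcoef i1 i2 i4 i5 i7 i8 i11 i13 i16 k l * i3 ^+ k * i6 ^+ l.
Proof.
move=> h288 E3 E5 E6 E7 E8 E11 E13 E16; rewrite /traceP E3 E5 E6 E7 E8 E11 E13 E16.
have -> : #72 * h * (#4 * i3) = i3 by transitivity (#288 * h * i3); [ring | rewrite h288 mul1r].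
have -> : #32 * h * (#9 * i5) = i5 by transitivity (#288 * h * i5); [ring | rewrite h288 mul1r].
have -> : #24 * h * (#12 * i7) = i7 by transitivity (#288 * h * i7); [ring | rewrite h288 mul1r].
have -> : #24 * h * (#12 * i8) = i8 by transitivity (#288 * h * i8); [ring | rewrite h288 mul1r].
have -> : #12 * h * (#24 * i11) = i11 by transitivity (#288 * h * i11); [ring | rewrite h288 mul1r].
have -> : #2 * h * (#144 * i13) = i13 by transitivity (#288 * h * i13); [ring | rewrite h288 mul1r].
by have -> : h * (#288 * i16) = i16 by transitivity (#288 * h * i16); [ring | rewrite h288 mul1r].
Qed.

(** Meant for concrete evaluations: the raw traces are replaced by given normal forms before P is
    expanded, which keeps each [ring] problem small. The invariant i16 is eliminated by squaring the
    sum that defines i11. *)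
Lemma traceP_value (A : comNzRingType) (h j1 j2 j4 j5 j6 j7 j8 j9 j10 : A)
    (i1 i2 i4 a2 b2 a3 b3 c d i3 i5 i6 i7 i8 i11 i13 : A)
    (i16 := #2 * i11 ^+ 2 - i3 ^+ 2 * i5 * i6)
    (p := pcoef i1 i2 i4 i5 i7 i8 i11 i13 i16) (m := fun k l => p k l * i3 ^+ k * i6 ^+ l) :
  #288 * h = 1 ->
  j1 = i1 -> j2 = i2 -> j4 = i4 -> j5 = a2 -> j6 = b2 -> j7 = a3 -> j8 = b3 ->
  j9 = c -> j10 = d ->
  a2 * b2 = #4 * i3 -> a3 * b3 = #9 * i5 -> c * d = i6 ->
  3 * (b2 * c ^+ 2 + a2 * d ^+ 2) + (b2 * a3 * d + a2 * b3 * c) = #12 * i7 ->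
  3 * (b2 * c ^+ 2 + a2 * d ^+ 2) - (b2 * a3 * d + a2 * b3 * c) = #12 * i8 ->
  a2 ^+ 2 * b3 * d + b2 ^+ 2 * a3 * c = #24 * i11 ->
  a3 ^+ 2 * b2 ^+ 3 + b3 ^+ 2 * a2 ^+ 3 = #144 * i13 ->
  traceP h j1 j2 j4 j5 j6 j7 j8 j9 j10 =
  (m 0%N 0%N + m 0%N 1%N + m 0%N 2%N + m 0%N 3%N + m 0%N 4%N)
  + (m 1%N 0%N + m 1%N 1%N + m 1%N 2%N + m 1%N 3%N + m 1%N 4%N)
  + (m 2%N 0%N + m 2%N 1%N + m 2%N 2%N + m 2%N 3%N + m 2%N 4%N)
  + (m 3%N 0%N + m 3%N 1%N + m 3%N 2%N + m 3%N 3%N + m 3%N 4%N)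
  + (m 4%N 0%N + m 4%N 1%N + m 4%N 2%N + m 4%N 3%N + m 4%N 4%N)
  + (m 5%N 0%N + m 5%N 1%N + m 5%N 2%N + m 5%N 3%N + m 5%N 4%N)
  + (m 6%N 0%N + m 6%N 1%N + m 6%N 2%N + m 6%N 3%N + m 6%N 4%N).
Proof.
move=> h288 -> -> -> -> -> -> -> -> -> E3 E5 E6 E7 E8 E11 E13.
have E16 : a2 ^+ 4 * b3 ^+ 2 * d ^+ 2 + b2 ^+ 4 * a3 ^+ 2 * c ^+ 2 = #288 * i16.
  transitivity ((a2 ^+ 2 * b3 * d + b2 ^+ 2 * a3 * c) ^+ 2
    - #2 * (a2 * b2) ^+ 2 * (a3 * b3) * (c * d)); first by ring.
  by rewrite E11 E3 E5 E6 /i16; ring.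
rewrite (traceP_values _ _ _ h288 E3 E5 E6 E7 E8 E11 E13 E16).
by rewrite !big_ord_recl !big_ord0 /bump /= !addr0 !addrA.
Qed.

Section MatrixSpaces.

Variable A : comNzRingType.
Implicit Types (al be : nat -> A).

Definition LIm al : 'M[A]_3 :=
  matrix3 [:: [:: al 3%N; al 2%N; 0]; [:: 0; al 4%N; al 0%N];
              [:: al 1%N; 0; - al 3%N - al 4%N]].

Definition L3m al : 'M[A]_3 :=
  matrix3 [:: [:: al 0%N; al 1%N; al 2%N]; [:: al 3%N; al 4%N; al 5%N];
              [:: al 6%N; al 7%N; - al 0%N - al 4%N]].

Definition polarP_I (h : A) al be : A := polarP h (LIm al) (LIm be)^T.
Definition polarP_L (h : A) al be : A := polarP h (L3m al) (L3m be)^T.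

Definition polarP1 (al be : nat -> A) : A :=
  let x := al 0%N in let y := al 1%N in let z := al 2%N in
  let u := al 3%N in let v := al 4%N in let w := - u - v in
  let x' := be 0%N in let y' := be 1%N in let z' := be 2%N in
  let u' := be 3%N in let v' := be 4%N in let w' := - u' - v' in
  (v - w) * (v' - w') * (x * x') ^+ 2 + (w - u) * (w' - u') * (y * y') ^+ 2
  + (u - v) * (u' - v') * (z * z') ^+ 2
  + ((v - w) * (v' - w') * (x * x') + y * y' * (z * z'))
    * (v * v' + w * w' - 5 * (u * u'))
  + ((w - u) * (w' - u') * (y * y') + z * z' * (x * x'))
    * (w * w' + u * u' - 5 * (v * v'))
  + ((u - v) * (u' - v') * (z * z') + x * x' * (y * y'))
    * (u * u' + v * v' - 5 * (w * w'))
  + (u - v) * (v - w) * (w - u) * ((u' - v') * (v' - w') * (w' - u')).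

Lemma polarP_scale (h l m : A) (X Y : 'M[A]_3) :
  polarP h (l *: X) (m *: Y) = l ^+ 12 * m ^+ 12 * polarP h X Y.
Proof.
rewrite /polarP !exprZn -!(scalerAl, scalerAr) !scalerA !mxtraceZ -traceP_homog.
congr traceP; ring.
Qed.

Lemma LIm_scale al (l : A) : LIm (fun k => al k * l ^+ 1) = l *: LIm al.
Proof.
apply/matrixP => j k; rewrite !mxE /= expr1.
by case: j => [[|[|[|j]]] jP] //; case: k => [[|[|[|k]]] kP] //=; ring.
Qed.

Lemma L3m_scale al (l : A) : L3m (fun k => al k * l ^+ 1) = l *: L3m al.
Proof.
apply/matrixP => j k; rewrite !mxE /= expr1.
by case: j => [[|[|[|j]]] jP] //; case: k => [[|[|[|k]]] kP] //=; ring.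
Qed.

Lemma polarP_I_sym (h : A) al be : polarP_I h al be = polarP_I h be al.
Proof. by rewrite /polarP_I -polarP_swap trmxK. Qed.

Lemma polarP_L_sym (h : A) al be : polarP_L h al be = polarP_L h be al.
Proof. by rewrite /polarP_L -polarP_swap trmxK. Qed.

Lemma polarP1_sym al be : polarP1 al be = polarP1 be al.
Proof. rewrite /polarP1; ring. Qed.

Lemma polarP_I_homog (h l : A) al be :
  polarP_I h (fun k => al k * l ^+ 1) (fun k => be k * l ^+ 0) = polarP_I h al be * l ^+ 12.
Proof.
have -> : polarP_I h (fun k => al k * l ^+ 1) (fun k => be k * l ^+ 0) =
    polarP h (l *: LIm al) (1 *: (LIm be)^T).
  by rewrite /polarP_I LIm_scale scale1r /LIm expr0 !mulr1.
by rewrite polarP_scale expr1n mulr1 mulrC.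
Qed.

Lemma polarP_L_homog (h l : A) al be :
  polarP_L h (fun k => al k * l ^+ 1) (fun k => be k * l ^+ 0) = polarP_L h al be * l ^+ 12.
Proof.
have -> : polarP_L h (fun k => al k * l ^+ 1) (fun k => be k * l ^+ 0) =
    polarP h (l *: L3m al) (1 *: (L3m be)^T).
  by rewrite /polarP_L L3m_scale scale1r /L3m expr0 !mulr1.
by rewrite polarP_scale expr1n mulr1 mulrC.
Qed.

Lemma polarP1_homog (l : A) al be :
  polarP1 (fun k => al k * l ^+ 1) (fun k => be k * l ^+ 0) = polarP1 al be * l ^+ 3.
Proof. rewrite /polarP1; ring. Qed.

(* Weights of the entries of l^2 D X D^-1 for D = diag(l, 1, 1/l), and of the  *)
(* transposed entries.                                                         *)
Definition torus_weight (k : nat) : nat := (2 + k %% 3 - k %/ 3)%N.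
Definition torus_coweight (k : nat) : nat := (2 + k %/ 3 - k %% 3)%N.

(** [E] plays the role of l D^-1, without inverting anything. The trace of a word of length m in X
    and Y is multiplied by l^m, and [polarP] has total degree 24. *)
Lemma polarP_conj (h l : A) (D E X Y : 'M[A]_3) : E * D = (l%:M : 'M[A]_3) ->
  polarP h (D * X * E) (D * Y * E) = l ^+ 24 * polarP h X Y.
Proof.
move=> ED.
have conjM U V : D * U * E * (D * V * E) = l *: (D * (U * V) * E).
  rewrite !mulrA -(mulrA (D * U) E D) ED -mulmxE scalar_mxC.
  by rewrite !mulmxE -!mulrA -mul_scalar_mx mulmxE !mulrA.
have conjT U : \tr (D * U * E) = l * \tr U.
  by rewrite -mulmxE mxtrace_mulC !mulmxE mulrA ED -mulmxE mul_scalar_mx mxtraceZ.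
have conjX U m : (D * U * E) ^+ m.+1 = l ^+ m *: (D * U ^+ m.+1 * E).
  elim: m => [|m IHm]; first by rewrite !expr1 expr0 scale1r.
  by rewrite exprSr IHm -scalerAl conjM scalerA -exprSr -exprSr.
rewrite /polarP !conjX; do 3! rewrite -?scalerAl -?scalerAr ?conjM.
rewrite !scalerA !mxtraceZ !conjT (_ : l ^+ 24 = l ^+ 12 * l ^+ 12); last by ring.
rewrite -traceP_homog; congr traceP; ring.
Qed.

Lemma polarP_L_torus (h l : A) al be :
  polarP_L h (fun k => al k * l ^+ torus_weight k) (fun k => be k * l ^+ torus_coweight k) =
  polarP_L h al be * l ^+ 48.
Proof.
pose D : 'M[A]_3 := matrix3 [:: [:: l ^+ 2; 0; 0]; [:: 0; l; 0]; [:: 0; 0; 1]].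
pose E : 'M[A]_3 := matrix3 [:: [:: 1; 0; 0]; [:: 0; l; 0]; [:: 0; 0; l ^+ 2]].
have mx9 (a b c d e f g i j a' b' c' d' e' f' g' i' j' : A) :
  [/\ a = a', b = b' & c = c'] -> [/\ d = d', e = e' & f = f'] ->
  [/\ g = g', i = i' & j = j'] ->
  matrix3 [:: [:: a; b; c]; [:: d; e; f]; [:: g; i; j]] =
  matrix3 [:: [:: a'; b'; c']; [:: d'; e'; f']; [:: g'; i'; j']].
  by move=> [-> -> ->] [-> -> ->] [-> -> ->].
have -> : polarP_L h (fun k => al k * l ^+ torus_weight k) (fun k => be k * l ^+ torus_coweight k) =
    polarP h (D * L3m al * E) (D * (L3m be)^T * E).
  rewrite /polarP_L /L3m !matrix3_tr !matrix3_mul /torus_weight /torus_coweight.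
  by refine (congr2 (polarP h) _ _); apply: mx9; split; rewrite /=; ring.
rewrite (@polarP_conj _ (l ^+ 2)) -?exprM 1?mulrC //.
apply/matrixP => j k; rewrite matrix3_mul !mxE.
by case: j => [[|[|[|j]]] jP] //; case: k => [[|[|[|k]]] kP] //=; ring.
Qed.

End MatrixSpaces.

Lemma rmorph_polarP_I (A B : comNzRingType) (phi : {rmorphism A -> B}) (h : A)
    (al be : nat -> A) (al' be' : nat -> B) :
  (forall k, (k.*2.+1 < 10)%N -> phi (al k) = al' k) ->
  (forall k, (k.*2.+1 < 10)%N -> phi (be k) = be' k) ->
  phi (polarP_I h al be) = polarP_I (phi h) al' be'.
Proof.
by move=> aa bb; rewrite /polarP_I rmorph_polarP /LIm -!map_trmx !map_matrix3
  !(rmorphB, rmorphN, rmorph0) !aa ?bb.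
Qed.

Lemma rmorph_polarP_L (A B : comNzRingType) (phi : {rmorphism A -> B}) (h : A)
    (al be : nat -> A) (al' be' : nat -> B) :
  (forall k, (k.*2.+1 < 16)%N -> phi (al k) = al' k) ->
  (forall k, (k.*2.+1 < 16)%N -> phi (be k) = be' k) ->
  phi (polarP_L h al be) = polarP_L (phi h) al' be'.
Proof.
by move=> aa bb; rewrite /polarP_L rmorph_polarP /L3m -!map_trmx !map_matrix3
  !(rmorphB, rmorphN, rmorph0) !aa ?bb.
Qed.

Lemma rmorph_polarP1 (A B : comNzRingType) (phi : {rmorphism A -> B}) (h : A)
    (al be : nat -> A) (al' be' : nat -> B) :
  (forall k, (k.*2.+1 < 10)%N -> phi (al k) = al' k) ->
  (forall k, (k.*2.+1 < 10)%N -> phi (be k) = be' k) ->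
  phi (polarP1 al be) = polarP1 al' be'.
Proof.
move=> aa bb; rewrite /polarP1.
rewrite -(aa 0%N) -?(aa 1%N) -?(aa 2%N) -?(aa 3%N) -?(aa 4%N) //.
rewrite -(bb 0%N) -?(bb 1%N) -?(bb 2%N) -?(bb 3%N) -?(bb 4%N) //.
ring.
Qed.

Section Polarization.

Variable C : numClosedFieldType.

Lemma P_polarP (X : 'M[C]_3) : P X = polarP (#288)^-1 X (adjoint X).
Proof.
have [J JE] : exists J : {rmorphism C -> C}, forall z, (z^*)%R = J z by exists Num.conj.
have trJ (U : 'M[C]_3) : J (\tr U) = \tr (adjoint U).
  by rewrite -JE /adjoint mxtrace_tr trace_map_mx.
have adjM (U V : 'M[C]_3) : adjoint (U * V) = adjoint V * adjoint U.
  by rewrite /adjoint -!mulmxE map_mxM trmx_mul.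
have adjX (U : 'M[C]_3) m : adjoint (U ^+ m) = adjoint U ^+ m.
  elim: m => [|m IHm]; first by rewrite !expr0 /adjoint map_mx1 trmx1.
  by rewrite exprS adjM IHm -exprSr.
have adjK : adjoint (adjoint X) = X.
  by apply/matrixP => i j; rewrite !mxE conjCK.
set Y := adjoint X in adjK *.
have cE : J (\tr (X ^+ 2 * Y)) = \tr (X * Y ^+ 2) by rewrite trJ adjM adjX adjK.
have dE : J (\tr (X * Y ^+ 2)) = \tr (X ^+ 2 * Y) by rewrite trJ adjM adjX adjK.
have aE m : J (\tr (X ^+ m)) = \tr (Y ^+ m) by rewrite trJ adjX.
have bE m : J (\tr (Y ^+ m)) = \tr (X ^+ m) by rewrite trJ adjX adjK.
rewrite /P /polarP (@traceP_values C _ _ _ _ _ _ _ _ _ _ (inv3 X) (inv5 X) (inv6 X) (inv7 X)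
  (inv8 X) (inv11 X) (inv13 X) (inv16 X)) //.
all: rewrite /inv3 /inv5 /inv6 /inv7 /inv8 /inv11 /inv13 /inv16 -/Y ?normCK ?ReE ?JE;
  rewrite ?(rmorph_nat, rmorphM, rmorphD, rmorphN, rmorphXn) ?cE ?dE ?aE ?bE; by field.
Qed.

Lemma P_polarP_I (al : nat -> C) : P (LIm al) = polarP_I (#288)^-1 al (fun k => ((al k)^*)%R).
Proof.
rewrite P_polarP /polarP_I; congr polarP; rewrite /adjoint /LIm map_matrix3.
by rewrite rmorphB rmorphN rmorph0.
Qed.

Lemma P_polarP_L (al : nat -> C) : P (L3m al) = polarP_L (#288)^-1 al (fun k => ((al k)^*)%R).
Proof.
rewrite P_polarP /polarP_L; congr polarP; rewrite /adjoint /L3m map_matrix3.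
by rewrite rmorphB rmorphN.
Qed.

Lemma P1_polarP1 (al : nat -> C) : P1 (LIm al) = polarP1 al (fun k => ((al k)^*)%R).
Proof.
rewrite /P1 /polarP1 /LIm !mxE /= !normCK !(rmorphM, rmorphB, rmorphN, rmorphXn) /=.
ring.
Qed.

End Polarization.

(** * Slices and points *)

Definition vec {A : pzRingType} (s : seq int) (k : nat) : A := (nth 0 s k)%:~R.

(* Found by computer search: base + s dirS + t dirT is the al-part of a slice,  *)
(* conj its be-part. Those for P2 and P are doubled to avoid fractions.         *)
Local Notation base1 := (vec [:: 1; 1; 0; 1; 0]).
Local Notation dirS1 := (vec [:: 0; 2; 0; 0; 0]).
Local Notation dirT1 := (vec [:: 0; 0; 1; 1; -1]).
Local Notation conj1 := (vec [:: 2; -1; -1; 1; -1]).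
Local Notation baseI := (vec [:: -6; 0; -2; 2; -2]).
Local Notation dirSI := (vec [:: 0; 0; 0; -2; 4]).
Local Notation dirTI := (vec [:: 0; 6; 2; 0; -2]).
Local Notation conjI := (vec [:: 1; 1; 3; 0; 1]).
Local Notation diag := (vec [:: 0; 0; 0; 1; 2]).
Local Notation baseL := (vec [:: 0; 2; 0; -2]).
Local Notation dirSL := (vec [:: 0; 0; 0; 0; 0; 0; 2]).
Local Notation dirTL := (vec [:: 0; 0; 2]).
Local Notation conjL := (vec [:: 0; 0; 0; 1; 0; 0; 0; 1]).
Local Notation diagL := (vec [:: 1; 0; 0; 0; 2]).
Local Notation diagL' := (vec [:: 1; 0; 0; 0; -1]).

Section Evaluations.

Variables (A : comNzRingType) (h s t : A).
Hypothesis h288 : #288 * h = 1.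

Lemma polarP1_slice :
  polarP1 (fun k => base1 k + s * dirS1 k + t * dirT1 k) conj1 =
  t * (#4 * s ^+ 2 - #9) + #8 * s ^+ 2.
Proof. by unfold polarP1, vec; cbn [nth]; ring. Qed.

Lemma polarP1_infinity :
  polarP1 (fun k => 1 * dirS1 k + 1 * dirT1 k) conj1 = #4 :> A.
Proof. by unfold polarP1, vec; cbn [nth]; ring. Qed.

Lemma polarP1_zero : polarP1 base1 conj1 = 0 :> A.
Proof. by unfold polarP1, vec; cbn [nth]; ring. Qed.

Lemma polarP1_nonzero : polarP1 base1 diag = - #40 :> A.
Proof. by unfold polarP1, vec; cbn [nth]; ring. Qed.

Ltac matrix_traces :=
  rewrite /polarP_I /polarP_L /LIm /L3m matrix3_tr /vec /polarP; cbn [nth];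
  rewrite !(exprSr _ 2) !expr2 !matrix3_mul !matrix3_trace.

(** The first factor is the square of P1 on the same slice ([polarP1_slice_I]), so the second one is
    the restriction of P2. The arguments passed to [traceP_value] are the traces and invariants on
    the slice, each verified by [ring]. *)
Lemma polarP_I_slice :
  polarP_I h (fun k => baseI k + s * dirSI k + t * dirTI k) conjI =
  (- #360 * s ^+ 2 * t - #72 * s ^+ 2 + #1152 * s * t ^+ 2 + #288 * s * t + #72 * s
  - #512 * t ^+ 3 - #768 * t ^+ 2 + #192 * t + #8) ^+ 2 * (#15552 * (- #4 * s ^+ 6
  + #27 * s ^+ 4 * t ^+ 2 - #6 * s ^+ 4 * t + #27 * s ^+ 4 - #192 * s ^+ 2 * t ^+ 2
  + #256 * t ^+ 3)).
Proof.
matrix_traces; rewrite (traceP_value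
    (i1 := #6 * s + #8 * t - #14) (i2 := #20 * s ^+ 2 + #12 * s * t - #28 * s
    + #20 * t ^+ 2 - #100 * t + #40) (i4 := #312 * s ^+ 2 * t - #312 * s ^+ 2
    - #144 * s * t ^+ 2 - #528 * s * t + #456 * s + #104 * t ^+ 3 + #144 * t ^+ 2
    + #552 * t - #368) (a2 := #24 * s ^+ 2 - #24 * s * t - #24 * s + #8 * t ^+ 2
    + #8 * t + #8) (b2 := #2) (a3 := #48 * s ^+ 3 - #72 * s ^+ 2 * t - #72 * s ^+ 2
    + #24 * s * t ^+ 2 + #96 * s * t + #24 * s - #240 * t ^+ 2 + #192 * t) (b3 := #9)
    (c := #12 * s ^+ 2 - #20 * s * t - #40 * s + #32 * t + #16) (d := #2 * s - #8)
    (i3 := #12 * s ^+ 2 - #12 * s * t - #12 * s + #4 * t ^+ 2 + #4 * t + #4)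
    (i5 := #48 * s ^+ 3 - #72 * s ^+ 2 * t - #72 * s ^+ 2 + #24 * s * t ^+ 2
    + #96 * s * t + #24 * s - #240 * t ^+ 2 + #192 * t) (i6 := #24 * s ^+ 3
    - #40 * s ^+ 2 * t - #176 * s ^+ 2 + #224 * s * t + #352 * s - #256 * t - #128)
    (i7 := #328 * s ^+ 4 - #864 * s ^+ 3 * t - #1720 * s ^+ 3 + #648 * s ^+ 2 * t ^+ 2
    + #3240 * s ^+ 2 * t + #2760 * s ^+ 2 - #120 * s * t ^+ 3 - #1752 * s * t ^+ 2
    - #3336 * s * t - #1648 * s + #192 * t ^+ 3 + #1248 * t ^+ 2 + #672 * t + #352)
    (i8 := - #136 * s ^+ 4 + #336 * s ^+ 3 * t + #328 * s ^+ 3 - #232 * s ^+ 2 * t ^+ 2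
    - #472 * s ^+ 2 * t + #392 * s ^+ 2 + #120 * s * t ^+ 3 + #344 * s * t ^+ 2
    - #760 * s * t - #528 * s - #192 * t ^+ 3 + #32 * t ^+ 2 + #608 * t + #160)
    (i11 := #528 * s ^+ 5 - #1168 * s ^+ 4 * t - #3056 * s ^+ 4
    + #1008 * s ^+ 3 * t ^+ 2 + #5776 * s ^+ 3 * t + #4832 * s ^+ 3
    - #368 * s ^+ 2 * t ^+ 3 - #4800 * s ^+ 2 * t ^+ 2 - #6096 * s ^+ 2 * t
    - #3520 * s ^+ 2 + #48 * s * t ^+ 4 + #2176 * s * t ^+ 3 + #3984 * s * t ^+ 2
    + #1504 * s * t + #1264 * s - #192 * t ^+ 4 - #1664 * t ^+ 3 - #192 * t ^+ 2
    + #128 * t - #192) (i13 := #7904 * s ^+ 6 - #23712 * s ^+ 5 * t - #23712 * s ^+ 5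
    + #31520 * s ^+ 4 * t ^+ 2 + #55520 * s ^+ 4 * t + #31520 * s ^+ 4
    - #23520 * s ^+ 3 * t ^+ 3 - #56672 * s ^+ 3 * t ^+ 2 - #54368 * s ^+ 3 * t
    - #23520 * s ^+ 3 + #10400 * s ^+ 2 * t ^+ 4 + #30688 * s ^+ 2 * t ^+ 3
    + #39840 * s ^+ 2 * t ^+ 2 + #27232 * s ^+ 2 * t + #10400 * s ^+ 2
    - #2592 * s * t ^+ 5 - #8416 * s * t ^+ 4 - #15008 * s * t ^+ 3
    - #11552 * s * t ^+ 2 - #7264 * s * t - #2592 * s + #288 * t ^+ 6 + #864 * t ^+ 5
    + #4928 * t ^+ 4 - #3104 * t ^+ 3 + #3776 * t ^+ 2 + #864 * t + #288)
  h288); [unfold pcoef; ring | ring ..].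
Qed.

Lemma polarP1_slice_I :
  polarP1 (fun k => baseI k + s * dirSI k + t * dirTI k) conjI =
  - #360 * s ^+ 2 * t - #72 * s ^+ 2 + #1152 * s * t ^+ 2 + #288 * s * t + #72 * s
  - #512 * t ^+ 3 - #768 * t ^+ 2 + #192 * t + #8.
Proof. by unfold polarP1, vec; cbn [nth]; ring. Qed.

Lemma polarP_I_infinity :
  polarP_I h (fun k => 1 * dirSI k + 1 * dirTI k) conjI =
  2 ^+ 12 * 3 ^+ 5 * 5 ^+ 2 * 7 ^+ 2 * #23.
Proof.
matrix_traces; rewrite (traceP_value
    (i1 := #14) (i2 := #52) (i4 := #272) (a2 := #8) (b2 := #2) (a3 := 0) (b3 := #9)
    (c := - #8) (d := #2) (i3 := #4) (i5 := 0) (i6 := - #16) (i7 := - #8) (i8 := #88)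
    (i11 := #48) (i13 := #288)
  h288); [unfold pcoef; ring | ring ..].
Qed.

Lemma polarP_I_zero :
  polarP_I h baseI conjI =
  0.
Proof.
matrix_traces; rewrite (traceP_value
    (i1 := - #14) (i2 := #40) (i4 := - #368) (a2 := #8) (b2 := #2) (a3 := 0) (b3 := #9)
    (c := #16) (d := - #8) (i3 := #4) (i5 := 0) (i6 := - #128) (i7 := #352) (i8 := #160)
    (i11 := - #192) (i13 := #288)
  h288); [unfold pcoef; ring | ring ..].
Qed.

Lemma polarP1_nonzero_I : polarP1 baseI conjI = #8 :> A.
Proof. by unfold polarP1, vec; cbn [nth]; ring. Qed.

Lemma polarP_I_nonzero :
  polarP_I h baseI diag =
  - (2 ^+ 20 * 3 ^+ 7 * 5 ^+ 2).
Proof.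
matrix_traces; rewrite (traceP_value
    (i1 := - #2) (i2 := #20) (i4 := - #56) (a2 := #8) (b2 := #14) (a3 := 0)
    (b3 := - #18) (c := #12) (d := - #6) (i3 := #28) (i5 := 0) (i6 := - #72)
    (i7 := #432) (i8 := #720) (i11 := #288) (i13 := #1152)
  h288); [unfold pcoef; ring | ring ..].
Qed.

(** Here Y = E12 + E23 is nilpotent, so tr(Y^2) = tr(Y^3) = 0. Then i3, i5, i11 and i13 vanish, and
    only the coefficients p_0l contribute. *)
Lemma polarP_L_slice :
  polarP_L h (fun k => baseL k + s * dirSL k + t * dirTL k) conjL =
  #4096 * (- #2304 * s ^+ 9 * t ^+ 3 + #5184 * s ^+ 8 * t ^+ 2 + #729 * s ^+ 8
  - #4698 * s ^+ 7 * t + #33 * s ^+ 6 * t ^+ 2 + #1944 * s ^+ 6 - #252 * s ^+ 5 * t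
  + #228 * s ^+ 4 - #12 * s ^+ 3 * t + #12 * s ^+ 2).
Proof.
matrix_traces; rewrite (traceP_value
    (i1 := - #2) (i2 := 0) (i4 := 0) (a2 := #8 * s * t - #8) (b2 := 0) (a3 := 0)
    (b3 := 0) (c := #4 * s) (d := #2 * s) (i3 := 0) (i5 := 0) (i6 := #8 * s ^+ 2)
    (i7 := #8 * s ^+ 3 * t - #8 * s ^+ 2) (i8 := #8 * s ^+ 3 * t - #8 * s ^+ 2)
    (i11 := 0) (i13 := 0)
  h288); [unfold pcoef; ring | ring ..].
Qed.

Lemma polarP_L_infinity :
  polarP_L h (fun k => 1 * dirSL k + 1 * dirTL k) conjL =
  - (#2304 * #4096).
Proof.
matrix_traces; rewrite (traceP_value
    (i1 := 0) (i2 := 0) (i4 := 0) (a2 := #8) (b2 := 0) (a3 := 0) (b3 := 0) (c := 0)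
    (d := #2) (i3 := 0) (i5 := 0) (i6 := 0) (i7 := #8) (i8 := #8) (i11 := 0) (i13 := 0)
  h288); [unfold pcoef; ring | ring ..].
Qed.

Lemma polarP_L_diagonal :
  polarP_L h diagL diagL' =
  - (2 ^+ 8 * 3 ^+ 7 * 5 ^+ 2).
Proof.
matrix_traces; rewrite (traceP_value
    (i1 := - #1) (i2 := #5) (i4 := - #7) (a2 := #14) (b2 := #2) (a3 := - #18) (b3 := 0)
    (c := - #3) (d := #3) (i3 := #7) (i5 := 0) (i6 := - #9) (i7 := #27) (i8 := #45)
    (i11 := #9) (i13 := #18)
  h288); [unfold pcoef; ring | ring ..].
Qed.

End Evaluations.

(** * Irreducibility *)

Section Irreducibility.

Context {R : realType} {n : nat}.
Hypothesis n_odd : odd n.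
Implicit Types (f g h p : {mpoly R[i][n.+1]}).

Notation hol := (whomog (fun=> 1%N) (fun=> 0%N)).
Notation antihol := (whomog (fun=> 0%N) (fun=> 1%N)).

Lemma whomog_swap wa wb M p : whomog wa wb M p -> whomog wb wa M (swap p).
Proof.
move=> pM; rewrite /whomog [LHS](cev_swap n_odd).
have := congr1 (map_poly (@swap R n)) pM.
rewrite rmorphM /= map_polyC map_polyXn /= => <-.
apply/esym; apply: (rmorph_cev n_odd (phi := map_poly (@swap R n))) => [c|k kn|k kn] /=.
- by rewrite map_polyC /=; congr _%:P; exact: cevC.
- rewrite rmorphM /= map_polyC map_polyXn /=; congr (_%:P * _); exact: cev_zvar.
- rewrite rmorphM /= map_polyC map_polyXn /=; congr (_%:P * _); exact: cev_zbar.
Qed.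

Lemma hol0 p : hol 0 p -> forall al be, pev al be p = pev (fun=> 0) be p.
Proof.
move=> p0 al be; have := whomog_pev n_odd p0 al be 0; rewrite expr0 mulr1 => <-.
by apply: eq_cev => // k _; rewrite ?expr1 ?mulr0 ?expr0 ?mulr1.
Qed.

Lemma antihol0 p : antihol 0 p -> forall al be, pev al be p = pev al (fun=> 0) p.
Proof.
move=> p0 al be; have := whomog_pev n_odd p0 al be 0; rewrite expr0 mulr1 => <-.
by apply: eq_cev => // k _; rewrite ?expr1 ?mulr0 ?expr0 ?mulr1.
Qed.

Lemma const_unit p : p != 0 -> hol 0 p -> antihol 0 p -> p \is a GRing.unit.
Proof.
move=> p0 ph pa; set c := pev (fun=> 0) (fun=> 0) p.
have pc : p = c%:MP.
  apply: pev_eq => al be; rewrite hol0 // antihol0 //; apply/esym; exact: cevC.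
by move: p0; rewrite pc mpolyC_eq0 -unitfE => /(rmorph_unit (@mpolyC n.+1 R[i])).
Qed.

Lemma hol_nonunit f N : (0 < N)%N -> hol N f -> f \isn't a GRing.unit.
Proof.
move=> N0 fN; have := whomog_pev n_odd fN (fun=> 0) (fun=> 0) 0.
have z : (0 : R[i]) ^+ N = 0 by rewrite expr0n (gtn_eqF N0).
rewrite {}z [in RHS]mulr0.
set al := (al in pev al _ f); set be := (be in pev _ be f) => f0.
apply/negP => /divrr/(congr1 (pev al be)); rewrite rmorphM rmorph1 /= f0 mul0r.
by move/eqP; rewrite eq_sym oner_eq0.
Qed.

(** The slice gives a factor of degree 0 in al; applied to [swap f = f], it gives one of degree 0 in
    be. If they coincide, that factor is constant. Otherwise f = g(be) h(al), and f(al1, be0) = 0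
    means g(be0) = 0 or h(al1) = 0, against f being nonzero at infinity over be0, respectively at
    (al1, be1). *)
Lemma bihomog_irreducible f N v0 v1 v2 be0 s0 t0 al1 be1 :
  (0 < N)%N -> swap f = f -> hol N f ->
  (forall G H, slice v0 v1 v2 be0 f = G * H ->
    (exists c, G = c%:P%:P) \/ (exists c, H = c%:P%:P)) ->
  pev (fun k => s0 * v1 k + t0 * v2 k) be0 f != 0 ->
  pev al1 be0 f = 0 -> pev al1 be1 f != 0 ->
  irreducible_elt f.
Proof.
move=> N0 fS fN irr finf f10 f11.
have f0 : f != 0 by apply: contraNneq f11 => ->; rewrite rmorph0.
split=> //; first exact: hol_nonunit fN.
move=> g h fE.
have gh0 : g * h != 0 by rewrite -fE.
have /andP[g0 h0] : (g != 0) && (h != 0) by rewrite -negb_or -mulf_eq0.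
have side p q a b : f = p * q -> hol a p -> hol b q -> a = 0%N \/ b = 0%N.
  move=> pq pa qb; move: finf; rewrite pq rmorphM mulf_eq0 negb_or => /andP[pinf qinf].
  have const r : (exists c, slice v0 v1 v2 be0 r = c%:P%:P) ->
      exists c, slice v0 v1 v2 be0 r = (c *: 'X^0)%:P.
    by move=> [c rc]; exists c; rewrite rc expr0 alg_polyC.
  case: (irr (slice v0 v1 v2 be0 p) (slice v0 v1 v2 be0 q)).
  - by rewrite pq rmorphM.
  - by move=> /const[c pc]; left; case: (slice_monomial n_odd pa pc pinf).
  - by move=> /const[c qc]; right; case: (slice_monomial n_odd qb qc qinf).
have fNgh : hol N (g * h) by rewrite -fE.
have [a [a' [_ ga ha]]] := whomog_factor n_odd gh0 fNgh.
have fNgh' : antihol N (g * h) by rewrite -fE -fS; exact: whomog_swap.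
have [b [b' [_ gb hb]]] := whomog_factor n_odd gh0 fNgh'.
have fE' : f = swap g * swap h by rewrite -rmorphM /= -fE.
have := side _ _ _ _ fE' (whomog_swap gb) (whomog_swap hb).
have := side _ _ _ _ fE ga ha.
have fev al be : pev al be f = pev al be g * pev al be h by rewrite fE rmorphM.
case=> z1 [] z2; subst;
  [by left; apply: const_unit | exfalso | exfalso | by right; apply: const_unit].
- move: finf f10 f11; rewrite !fev => finf /eqP; rewrite mulf_eq0 => /orP[] z.
    by case/eqP: finf; rewrite (hol0 ga) -(hol0 ga al1) (eqP z) mul0r.
  by rewrite (antihol0 hb) -(antihol0 hb _ be0) (eqP z) mulr0 eqxx.
- move: finf f10 f11; rewrite !fev => finf /eqP; rewrite mulf_eq0 => /orP[] z.
    by rewrite (antihol0 gb) -(antihol0 gb _ be0) (eqP z) mul0r eqxx.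
  by case/eqP: finf; rewrite (hol0 ha) -(hol0 ha al1) (eqP z) mulr0.
Qed.

End Irreducibility.

(** * The polynomials of P1, P2 and P in the complex coordinates *)

Section PolarizedPolynomials.

Context {R : realType}.

Definition inv288 : R[i] := (#288)^-1.

Definition formalI : {mpoly R[i][10]} := formal 9 (@polarP_I) inv288.
Definition formalL : {mpoly R[i][16]} := formal 15 (@polarP_L) inv288.
Definition formal1 : {mpoly R[i][10]} := formal 9 (fun A _ => @polarP1 A) inv288.

Lemma conj_inv288 : conjc inv288 = inv288.
Proof. by rewrite /inv288 conjc_inv conjc_nat. Qed.

Lemma inv288E (A : comNzRingType) (iota : {rmorphism R[i] -> A}) : #288 * iota inv288 = 1.
Proof.
by rewrite -(rmorph_nat iota) -rmorphM mulfV ?rmorph1 // pnatr_eq0.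
Qed.

Lemma cev_formalI (A : comNzRingType) (iota : {rmorphism R[i] -> A}) al be :
  cev iota al be formalI = polarP_I (iota inv288) al be.
Proof. exact: (cev_formal (n := 9) (Phi := @polarP_I) isT inv288 (@rmorph_polarP_I)). Qed.

Lemma cev_formalL (A : comNzRingType) (iota : {rmorphism R[i] -> A}) al be :
  cev iota al be formalL = polarP_L (iota inv288) al be.
Proof.
exact: (cev_formal (n := 15) (Phi := @polarP_L) isT inv288 (@rmorph_polarP_L)).
Qed.

Lemma cev_formal1 (A : comNzRingType) (iota : {rmorphism R[i] -> A}) al be :
  cev iota al be formal1 = polarP1 al be.
Proof.
exact: (cev_formal (n := 9) (Phi := fun A _ => @polarP1 A) isT inv288 (@rmorph_polarP1)).
Qed.

Lemma swap_formalI : swap formalI = formalI.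
Proof.
exact: (swap_formal (n := 9) (Phi := @polarP_I) isT
  inv288 (@rmorph_polarP_I) (@polarP_I_sym)).
Qed.

Lemma swap_formalL : swap formalL = formalL.
Proof.
exact: (swap_formal (n := 15) (Phi := @polarP_L) isT
  inv288 (@rmorph_polarP_L) (@polarP_L_sym)).
Qed.

Lemma swap_formal1 : swap formal1 = formal1.
Proof.
exact: (swap_formal (n := 9) (Phi := fun A _ => @polarP1 A) isT
  inv288 (@rmorph_polarP1) (fun A _ => @polarP1_sym A)).
Qed.

Notation hol := (whomog (fun=> 1%N) (fun=> 0%N)).

Lemma hol_formalI : hol 12 formalI.
Proof.
exact: (formal_homog (n := 9) (Phi := @polarP_I) isT
  inv288 (@rmorph_polarP_I) (@polarP_I_homog)).
Qed.

Lemma hol_formalL : hol 12 formalL.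
Proof.
exact: (formal_homog (n := 15) (Phi := @polarP_L) isT
  inv288 (@rmorph_polarP_L) (@polarP_L_homog)).
Qed.

Lemma hol_formal1 : hol 3 formal1.
Proof.
exact: (formal_homog (n := 9) (Phi := fun A _ => @polarP1 A) isT
  inv288 (@rmorph_polarP1) (fun A _ => @polarP1_homog A)).
Qed.

(** Integer coordinates make sense in every ring, so the identities over arbitrary rings apply to
    the slice with s and t as polynomial variables. *)
Lemma slice_vec n (n_odd : odd n) (v0 v1 v2 be0 : seq int) (p : {mpoly R[i][n.+1]}) :
  slice (vec v0) (vec v1) (vec v2) (vec be0) p =
  cev (polyC \o polyC) (fun k => vec v0 k + 'X%:P * vec v1 k + 'X * vec v2 k)
    (vec be0) p.
Proof.
have E z : (z%:~R)%:P%:P = z%:~R :> {poly {poly R[i]}} by rewrite !rmorph_int.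
by apply: eq_cev => // k _; rewrite /vec !E.
Qed.

Lemma P1_irreducible : irreducible_elt formal1.
Proof.
have E al be : pev al be formal1 = polarP1 al be by exact: cev_formal1.
apply: (@bihomog_irreducible R 9 isT formal1 3 base1 dirS1 dirT1 conj1 1 1 base1 diag).
- by [].
- exact: swap_formal1.
- exact: hol_formal1.
- move=> G H; rewrite slice_vec // cev_formal1 polarP1_slice => GH; apply: irreducible_linear.
  by rewrite polyCB (polyCM #4) (polyCM #8) polyC_exp !polyC_natr.
- by rewrite E polarP1_infinity pnatr_eq0.
- by rewrite E polarP1_zero.
- by rewrite E polarP1_nonzero oppr_eq0 pnatr_eq0.
Qed.

(** Symmetry, degree 12 - 6 = 6, the restriction to the slice and the needed values all pass from
    P_I to the quotient by cancelling the square of P1. *)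
Lemma P2_irreducible p2 : formal1 ^+ 2 * p2 = formalI -> irreducible_elt p2.
Proof.
move=> FE.
have E1 al be : pev al be formal1 = polarP1 al be by exact: cev_formal1.
have EI al be : pev al be formalI = polarP_I inv288 al be by exact: cev_formalI.
have h288 := inv288E idfun.
have E al be : polarP1 al be ^+ 2 * pev al be p2 = polarP_I inv288 al be.
  by rewrite -EI -FE rmorphM rmorphXn /= E1.
have f0 : formal1 != 0 by case: P1_irreducible.
have f20 : formal1 ^+ 2 != 0 by rewrite expf_neq0.
have hol2 : hol 6 (formal1 ^+ 2).
  have := hol_formal1; rewrite /whomog rmorphXn /= => ->.
  by rewrite exprMn -polyC_exp -exprM.
apply: (@bihomog_irreducible R 9 isT p2 6 baseI dirSI dirTI conjI 1 1 baseI diag).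
- by [].
- apply: (mulfI f20); rewrite FE -{1}swap_formal1 -rmorphXn -rmorphM /= FE.
  exact: swap_formalI.
- apply: (whomogM_cancel f20 hol2); rewrite FE; exact: hol_formalI.
- move=> G H; rewrite slice_vec //.
  set al : nat -> {poly {poly R[i]}} := fun k => _; set be := vec _ => GH.
  have := congr1 (cev (polyC \o polyC) al be) FE.
  rewrite rmorphM rmorphXn /= cev_formal1 cev_formalI polarP_I_slice; last exact: inv288E.
  (* P1 takes the value 8 at s = t = 0, so its square can be cancelled on the slice. *)
  have Q0 : polarP1 al be != 0.
    apply: contraTneq isT => Q0.
    have := @horner_slice R 9 isT baseI dirSI dirTI conjI formal1 0 0.
    rewrite slice_vec // cev_formal1 Q0 !horner0 E1 polarP1_slice_I => Z.
    suff /eqP : #8 = 0 :> R[i] by rewrite pnatr_eq0.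
    by rewrite [RHS]Z; ring.
  rewrite -polarP1_slice_I => /mulfI; rewrite GH expf_neq0 // => /(_ isT) GHE.
  exact: irreducible_slice_I (esym GHE).
- apply: contraTneq isT => z.
  have := E (fun k => 1 * dirSI k + 1 * dirTI k) conjI.
  rewrite z mulr0 polarP_I_infinity // => /esym/eqP.
  by rewrite !mulf_eq0 !pnatr_eq0.
- have /eqP := E baseI conjI.
  rewrite polarP_I_zero // polarP1_nonzero_I mulf_eq0 expf_eq0 pnatr_eq0 /=.
  by move/eqP.
- apply: contraTneq isT => z.
  have := E baseI diag.
  rewrite z mulr0 polarP_I_nonzero // => /esym/eqP.
  by rewrite oppr_eq0 !mulf_eq0 !pnatr_eq0.
Qed.

Lemma torus_formalL : whomog torus_weight torus_coweight 48 formalL.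
Proof.
exact: (formal_weigh (n := 15) (Phi := @polarP_L) isT
  inv288 (@rmorph_polarP_L) (@polarP_L_torus)).
Qed.

Notation antihol := (whomog (fun=> 0%N) (fun=> 1%N)).

Lemma eq_mul_exp2 (z : R[i]) m n : z != 0 -> z * 2 ^+ m = z * 2 ^+ n -> m = n.
Proof.
move=> z0 /(mulfI z0) /eqP; rewrite -!natrX eqr_nat eqn_exp2l //.
by move/eqP.
Qed.

(** The torus weight k is computed at two points where p does not vanish: k = 2 (a + b) and k = 3 b,
    whence b = 2 a. *)
Lemma torus_degrees (p : {mpoly R[i][16]}) a b k c i :
  hol a p -> antihol b p -> whomog torus_weight torus_coweight k p ->
  slice baseL dirSL dirTL conjL p = (c *: 'X^i)%:P ->
  pev (fun k => 1 * dirSL k + 1 * dirTL k) conjL p != 0 ->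
  pev diagL diagL' p != 0 ->
  a = i /\ b = (2 * a)%N.
Proof.
move=> pa pb pk ps pinf pdiag.
have [ai pE] := @slice_monomial R 15 isT _ _ _ _ a p c i 1 1 pa ps pinf.
have c0 : c != 0 by move: pinf; rewrite pE expr1n mulr1.
split=> //.
(* At a pair of diagonal matrices all nonzero coordinates have weight 2, in al and in be. *)
have kab : k = (2 * (a + b))%N.
  apply: (eq_mul_exp2 pdiag); rewrite exprM exprD mulrA.
  rewrite -(@whomog_pev R 15 isT _ _ _ _ pk) -(@whomog_pev R 15 isT _ _ _ _ pa).
  rewrite -(@whomog_pev R 15 isT _ _ _ _ pb).
  apply: eq_cev => // j; do 8?[case: j => [|j] //] => _;
    rewrite /vec /torus_weight /torus_coweight /=; ring.
(* At infinity with s = 1, t = 0, X is a multiple of E31, of weight 0, and both nonzero coordinates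
   of be have weight 3; the value there is c. *)
have kb : k = (3 * b)%N.
  have c1 := pE 1 0; rewrite expr1n mulr1 in c1.
  have d0 : pev (fun k => 1 * dirSL k + 0 * dirTL k) conjL p != 0 by rewrite c1.
  apply: (eq_mul_exp2 d0); rewrite exprM.
  rewrite -(@whomog_pev R 15 isT _ _ _ _ pk) -(@whomog_pev R 15 isT _ _ _ _ pb).
  apply: eq_cev => // j; do 8?[case: j => [|j] //] => _;
    rewrite /vec /torus_weight /torus_coweight /=; ring.
lia.
Qed.

Lemma P_factor_degrees g h a b a' b' : formalL = g * h -> hol a g -> antihol b g ->
  hol a' h -> antihol b' h ->
  ((a <= 2)%N /\ b = (2 * a)%N) \/ ((a' <= 2)%N /\ b' = (2 * a')%N).
Proof.
move=> gh ga gb ha hb.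
have E al be : pev al be g * pev al be h = polarP_L inv288 al be.
  by rewrite -rmorphM /= -gh; exact: cev_formalL.
have h288 := inv288E idfun.
have inf0 : polarP_L inv288 (fun k => 1 * dirSL k + 1 * dirTL k) conjL != 0.
  by rewrite polarP_L_infinity // oppr_eq0 mulf_neq0 // pnatr_eq0.
have diag0 : polarP_L inv288 diagL diagL' != 0.
  by rewrite polarP_L_diagonal // oppr_eq0 !mulf_eq0 !pnatr_eq0.
have gh0 : g * h != 0.
  by apply: contraNneq diag0 => z; rewrite -E -rmorphM z rmorph0.
have torgh : whomog torus_weight torus_coweight 48 (g * h).
  by rewrite -gh; exact: torus_formalL.
have [k [k' [_ gk hk]]] := @whomog_factor R 15 isT _ _ _ _ _ gh0 torgh.
move: inf0 diag0; rewrite -!E !mulf_eq0 !negb_or => /andP[g1 h1] /andP[g2 h2].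
have sl : slice baseL dirSL dirTL conjL formalL =
    slice baseL dirSL dirTL conjL g * slice baseL dirSL dirTL conjL h.
  by rewrite gh rmorphM.
move: sl; rewrite {1}slice_vec // cev_formalL polarP_L_slice; last exact: inv288E.
case/factor_slice_L => -[c [i [i2 s]]]; [left | right].
  by have [-> ->] := torus_degrees ga gb gk s g1 g2.
by have [-> ->] := torus_degrees ha hb hk s h1 h2.
Qed.

Lemma P_irreducible : irreducible_elt formalL.
Proof.
have f0 : formalL != 0.
  apply: contraTneq isT => z.
  have := cev_formalL idfun diagL diagL'.
  rewrite z rmorph0 polarP_L_diagonal; last exact: (inv288E idfun).
  by move/esym/eqP; rewrite oppr_eq0 !mulf_eq0 !pnatr_eq0.
split=> //; first exact: (@hol_nonunit R 15 isT formalL 12 isT hol_formalL).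
move=> g h fE.
have gh0 : g * h != 0 by rewrite -fE.
have /andP[g0 h0] : (g != 0) && (h != 0) by rewrite -negb_or -mulf_eq0.
have fNgh : hol 12 (g * h) by rewrite -fE; exact: hol_formalL.
have [a [a' [a12 ga ha]]] := @whomog_factor R 15 isT _ _ _ _ _ gh0 fNgh.
have fNgh' : antihol 12 (g * h).
  by rewrite -fE -swap_formalL; apply: (@whomog_swap R 15 isT); exact: hol_formalL.
have [b [b' [b12 gb hb]]] := @whomog_factor R 15 isT _ _ _ _ _ gh0 fNgh'.
have fE' : formalL = swap g * swap h by rewrite -rmorphM /= -fE swap_formalL.
have W := @whomog_swap R 15 isT.
have S1 := P_factor_degrees fE ga gb ha hb.
have S2 := P_factor_degrees fE' (W _ _ _ _ gb) (W _ _ _ _ ga) (W _ _ _ _ hb) (W _ _ _ _ ha).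
(* If [S1] and [S2] concern the same factor, b = 2 a and a = 2 b give degree (0, 0). If not, the
   be-degrees are at most 4 and 2 and cannot add up to 12. *)
have [[az bz] | [az bz]] : (a = 0%N /\ b = 0%N) \/ (a' = 0%N /\ b' = 0%N).
  by move: a12 b12 S1 S2; clear; lia.
- left; apply: (@const_unit R 15 isT) => //; [by rewrite az in ga | by rewrite bz in gb].
- right; apply: (@const_unit R 15 isT) => //; [by rewrite az in ha | by rewrite bz in hb].
Qed.

End PolarizedPolynomials.

(** * Return to real polynomials on L_I and L(3) *)

Section RealForms.
Context {R : realType}.

Lemma is_poly_of_P1 (p1 : {mpoly R[10]}) :
  map_mpoly (real_complex R) p1 = formal1 -> is_poly_of p1 (fun t => P1 (LI_mx t)).
Proof.
move=> p1E t; rewrite (@meval_real_complex R 9 isT (fun A _ => @polarP1 A)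
  inv288 (@rmorph_polarP1) p1 t p1E).
exact: (P1_polarP1 (ccoord t)).
Qed.

Lemma is_poly_of_polarP_I (p : {mpoly R[10]}) :
  map_mpoly (real_complex R) p = formalI -> is_poly_of p (fun t => P (LI_mx t)).
Proof.
move=> pE t; rewrite (@meval_real_complex R 9 isT (@polarP_I)
  inv288 (@rmorph_polarP_I) p t pE).
exact: (P_polarP_I (ccoord t)).
Qed.

Lemma is_poly_of_polarP_L (p : {mpoly R[16]}) :
  map_mpoly (real_complex R) p = formalL -> is_poly_of p (fun t => P (L3_mx t)).
Proof.
move=> pE t; rewrite (@meval_real_complex R 15 isT (@polarP_L)
  inv288 (@rmorph_polarP_L) p t pE).
exact: (P_polarP_L (ccoord t)).
Qed.

Lemma is_poly_of_unique n (p q : {mpoly R[n]}) f : is_poly_of p f -> is_poly_of q f -> p = q.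
Proof.
move=> pf qf; apply/eqP; rewrite -subr_eq0; apply/eqP/mpoly_eq0 => v.
have := pf v; rewrite qf => -[pq].
by rewrite mevalB pq subrr.
Qed.

End RealForms.

Theorem proposition9p4 (R : realType) :
  exists (p1 : {mpoly R[10]}) (p : {mpoly R[16]}),
    [/\ is_poly_of p1 (fun t => P1 (LI_mx t)) /\ absolutely_irreducible p1,
        forall p2 : {mpoly R[10]}, p2 \is 12.-homog ->
          is_poly_of (p1 ^+ 2 * p2) (fun t => P (LI_mx t)) ->
          absolutely_irreducible p2
      & is_poly_of p (fun t => P (L3_mx t)) /\ absolutely_irreducible p].
Proof.
have [p1 p1E] := @formal_real R 9 isT (fun A _ => @polarP1 A) inv288 (@rmorph_polarP1)
  (fun A _ => @polarP1_sym A) conj_inv288.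
have [pI pIE] := @formal_real R 9 isT (@polarP_I)
  inv288 (@rmorph_polarP_I) (@polarP_I_sym) conj_inv288.
have [p pE] := @formal_real R 15 isT (@polarP_L)
  inv288 (@rmorph_polarP_L) (@polarP_L_sym) conj_inv288.
exists p1, p; split.
- split; first exact: is_poly_of_P1.
  rewrite /absolutely_irreducible p1E; exact: P1_irreducible.
- move=> p2 _ p12; apply: P2_irreducible.
  (* Both polynomials represent P on L_I, so they agree; the equality of functions becomes a
     factorization of [formalI]. *)
  have pI12 := is_poly_of_unique p12 (is_poly_of_polarP_I pIE).
  by rewrite /formalI -pIE -pI12 rmorphM rmorphXn /= p1E.
- split; first exact: is_poly_of_polarP_L.
  rewrite /absolutely_irreducible pE; exact: P_irreducible.
Qed.
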